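(* Let $m,k$ be real constants with $k\geq m\geq 2$, and let $\gamma_1,\gamma_2,\gamma_3>0$ be real numbers such that either $$\gamma_1-\gamma_2-m^2\gamma_3-3m(k-1)\gamma_3-e(e+1)\geq e^2$$ or $$1-e-e\big(\gamma_1+\gamma_2+m^2\gamma_3+3m(k-1)\gamma_3\big)\geq e.$$ If $p$ is an analytic function in $\mathbb{D}$ such that $p(0)=1$ and $$p(z)+\gamma_1 zp'(z)+\gamma_2 z^2p''(z)+\gamma_3 z^3p'''(z)\prec 1+ze^z,$$ then $p(z)\prec e^z$.
   Context: $\mathbb{D}=\{z\in\mathbb{C}:|z|<1\}$ is the open unit disk. For analytic functions $g,h$ on $\mathbb{D}$, $g\prec h$ ($g$ is subordinate to $h$) means that there is an analytic function $w:\mathbb{D}\to\mathbb{D}$ with $w(0)=0$ and $|w(z)|\le|z|$ such that $g(z)=h(w(z))$ for all $z\in\mathbb{D}$. *)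

(* Defs.v *)
From Stdlib Require Import Reals.
From Coquelicot Require Import Coquelicot.

Open Scope R_scope.

Definition unit_disk (z : C) : Prop := Cmod z < 1.

(* Local expansion in a convergent power series.  A function on the disk is
   represented by a total function C -> C whose values outside are ignored. *)
Definition analytic_at (f : C -> C) (z0 : C) : Prop :=
  exists (a : nat -> C) (r : posreal),
    forall z : C, Cmod (z - z0)%C < r ->
      @is_pseries C_AbsRing C_NormedModule a (z - z0)%C (f z).

Definition analytic_on_disk (f : C -> C) : Prop :=
  forall z : C, unit_disk z -> analytic_at f z.

Definition subordinate (g h : C -> C) : Prop :=
  exists w : C -> C,
    analytic_on_disk w /\
    (forall z : C, unit_disk z -> unit_disk (w z)) /\
    w (RtoC 0) = RtoC 0 /\
    (forall z : C, unit_disk z -> Cmod (w z) <= Cmod z) /\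
    (forall z : C, unit_disk z -> g z = h (w z)).

Definition Cexp (z : C) : C :=
  (exp (Re z) * cos (Im z), exp (Re z) * sin (Im z)).

(* Main.v *)
Require Import Defs.
From Stdlib Require Import Reals Lra Lia Arith Classical ClassicalEpsilon.
From Coquelicot Require Import Coquelicot.

Open Scope R_scope.

(** Write [p = sum a_n z^n].  The operator
    [p + g1 z p' + g2 z^2 p'' + g3 z^3 p'''] multiplies [a_n] by a real cubic
    [Q n >= g1 n], and the hypothesis on the constants forces [g1 >= 5 e]: the
    second alternative contradicts the positivity of the [g_i], the first one
    gives [g1 >= e (2 e + 1)].  The image of [p] is [1 + w e^w] with
    [|w| < 1], so that it stays within distance [e] of [1].  Parseval's
    inequality bounds the l2-norm of the coefficients [Q n a_n], [n >= 1], by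
    [e]; since [1 / n] is square-summable, this makes [sum_{n >= 1} |a_n| r^n]
    at most [1 / 3] for every [r < 1] ([l1_bound_of_multiplier]).

    A function that close to [1] has a small logarithm.  The logarithm is built
    as the power series [W = sum w_n z^n] with [W 0 = 0] and [W' p = p'], an
    equation that determines the [w_n] recursively and turns the bound [1 / 3]
    into [sum |w_n| r^n <= 1 / 2] ([log_coef_bound]).  As [W] has no constant
    term this implies [|W z| <= |z|] ([schwarz_bound]), and [p = exp W] because
    [p exp (- W)] is constant on each radius
    ([Cexp_of_log_derivative]).

    This argument presupposes that a function that is a power series near each
    point of the disk is a single power series on the whole disk
    ([analytic_on_disk_psum]).  That is proved without integration.  By
    compactness, [f] has around each point of a smaller closed disk a Taylor
    series with uniform bounds [|b_n| d^n <= 1 / d].  While the series at [0]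
    represents [f] on [|z| < rho], its recentred coefficients
    [b_n z0 = sum_j binom (n + j) n a_{n+j} z0^j] are power series in [z0], and
    Cauchy's estimate for all of them together gives, through the binomial
    theorem, [|a_N| (rho + d / 2)^N <= 2 / d].  Hence the radius increases by a
    fixed amount at each step.  Cauchy's estimate and Parseval's inequality come
    from averaging over roots of unity. *)

(** * Finite sums and series of complex numbers *)

(** Equations between complex numbers may have their type displayed as a
    projection of an algebraic structure, where [ring] does not find its ring. *)
Ltac cring := cbv beta; match goal with |- ?a = ?b => change (@eq C a b); ring end.

Definition csum (u : nat -> C) (n : nat) : C := @sum_n C_AbelianMonoid u n.
Notation cseries := (@is_series C_AbsRing C_NormedModule).

Lemma csum_0 (u : nat -> C) : csum u 0 = u 0%nat.
Proof. exact (@sum_O C_AbelianMonoid u). Qed.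

Lemma csum_S (u : nat -> C) (n : nat) : csum u (S n) = (csum u n + u (S n))%C.
Proof. exact (@sum_Sn C_AbelianMonoid u n). Qed.

Lemma rsum_0 (u : nat -> R) : sum_n u 0 = u 0%nat.
Proof. exact (sum_O u). Qed.

Lemma rsum_S (u : nat -> R) (n : nat) : sum_n u (S n) = sum_n u n + u (S n).
Proof. exact (sum_Sn u n). Qed.

Lemma csum_ext (u v : nat -> C) (n : nat) :
  (forall k, (k <= n)%nat -> u k = v k) -> csum u n = csum v n.
Proof. exact (@sum_n_ext_loc C_AbelianMonoid u v n). Qed.

Lemma csum_plus (u v : nat -> C) (n : nat) :
  csum (fun k => (u k + v k)%C) n = (csum u n + csum v n)%C.
Proof. exact (@sum_n_plus C_AbelianMonoid u v n). Qed.

Lemma csum_mult_l (c : C) (u : nat -> C) (n : nat) :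
  csum (fun k => (c * u k)%C) n = (c * csum u n)%C.
Proof. exact (@sum_n_mult_l C_Ring c u n). Qed.

Lemma csum_zero (u : nat -> C) (n : nat) :
  (forall k, (k <= n)%nat -> u k = RtoC 0) -> csum u n = RtoC 0.
Proof.
intros H. induction n as [|n IH].
- rewrite csum_0. apply H; lia.
- rewrite csum_S, IH, H by (intros; try apply H; lia). cring.
Qed.

Lemma csum_shift (u : nat -> C) (n : nat) :
  csum u (S n) = (u 0%nat + csum (fun k => u (S k)) n)%C.
Proof.
induction n as [|n IH].
- now rewrite csum_S, !csum_0.
- rewrite csum_S, IH, (csum_S (fun k => u (S k))). cring.
Qed.

Lemma csum_RtoC (u : nat -> R) (n : nat) :
  csum (fun k => RtoC (u k)) n = RtoC (sum_n u n).
Proof.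
induction n as [|n IH].
- now rewrite csum_0, rsum_0.
- rewrite csum_S, rsum_S, IH, RtoC_plus. reflexivity.
Qed.

Lemma rsum_le (u v : nat -> R) (n : nat) :
  (forall k, (k <= n)%nat -> u k <= v k) -> sum_n u n <= sum_n v n.
Proof.
intros H. induction n as [|n IH].
- rewrite !rsum_0. apply H; lia.
- rewrite !rsum_S. apply Rplus_le_compat; [apply IH; intros; apply H | apply H]; lia.
Qed.

Lemma rsum_ext (u v : nat -> R) (n : nat) :
  (forall k, (k <= n)%nat -> u k = v k) -> sum_n u n = sum_n v n.
Proof. exact (sum_n_ext_loc u v n). Qed.

Lemma rsum_plus (u v : nat -> R) (n : nat) :
  sum_n (fun k => u k + v k) n = sum_n u n + sum_n v n.
Proof. exact (sum_n_plus u v n). Qed.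

Lemma rsum_mult_l (c : R) (u : nat -> R) (n : nat) :
  sum_n (fun k => c * u k) n = c * sum_n u n.
Proof. exact (sum_n_mult_l c u n). Qed.

Lemma rsum_ge0 (u : nat -> R) (n : nat) :
  (forall k, (k <= n)%nat -> 0 <= u k) -> 0 <= sum_n u n.
Proof.
intros H. induction n as [|n IH].
- rewrite rsum_0. apply H; lia.
- rewrite rsum_S. apply Rplus_le_le_0_compat; [apply IH; intros; apply H | apply H]; lia.
Qed.

Lemma rsum_term_le (u : nat -> R) (n k : nat) :
  (forall k, 0 <= u k) -> (k <= n)%nat -> u k <= sum_n u n.
Proof.
intros H. induction n as [|n IH]; intros Hk.
- replace k with 0%nat by lia. rewrite rsum_0. lra.
- rewrite rsum_S. destruct (Nat.eq_dec k (S n)) as [->|Hne].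
  + assert (0 <= sum_n u n) by (apply rsum_ge0; auto). lra.
  + assert (u k <= sum_n u n) by (apply IH; lia). specialize (H (S n)). lra.
Qed.

Lemma rsum_mono (u : nat -> R) (n m : nat) :
  (forall k, 0 <= u k) -> (n <= m)%nat -> sum_n u n <= sum_n u m.
Proof.
intros H Hnm. induction Hnm as [|m Hnm IH]; [lra|].
rewrite rsum_S. specialize (H (S m)). lra.
Qed.

Lemma Cmod_csum (u : nat -> C) (n : nat) :
  Cmod (csum u n) <= sum_n (fun k => Cmod (u k)) n.
Proof.
induction n as [|n IH].
- rewrite csum_0, rsum_0. lra.
- rewrite csum_S, rsum_S. eapply Rle_trans; [apply Cmod_triangle|]. lra.
Qed.

Lemma Cmod_minus_sym (x y : C) : Cmod (x - y) = Cmod (y - x).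
Proof. rewrite <- Cmod_opp. f_equal. cring. Qed.

Lemma Cmod_minus_triangle (x y z : C) : Cmod (x - z) <= Cmod (x - y) + Cmod (y - z).
Proof. replace (x - z)%C with ((x - y) + (y - z))%C by cring. apply Cmod_triangle. Qed.

Lemma cseries_eps (u : nat -> C) (l : C) :
  cseries u l <->
  (forall eps, 0 < eps -> exists N, forall n, (N <= n)%nat -> Cmod (csum u n - l) < eps).
Proof.
split.
- intros H eps Heps.
  assert (H2 := proj1 (filterlim_locally_ball_norm (K:=C_AbsRing) (U:=C_NormedModule) (F:=eventually) (csum u) l) H (mkposreal eps Heps)).
  destruct H2 as [N HN]. exists N. intros n Hn. specialize (HN n Hn).
  unfold ball_norm in HN. exact HN.
- intros H.
  apply (proj2 (filterlim_locally_ball_norm (K:=C_AbsRing) (U:=C_NormedModule) (F:=eventually) (csum u) l)).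
  intros eps. destruct (H eps (cond_pos eps)) as [N HN]. exists N. intros n Hn.
  exact (HN n Hn).
Qed.

Lemma cseries_ext (u v : nat -> C) (l : C) :
  (forall n, u n = v n) -> cseries u l -> cseries v l.
Proof. apply (@is_series_ext C_AbsRing C_NormedModule). Qed.

Lemma cseries_plus (u v : nat -> C) (l m : C) :
  cseries u l -> cseries v m -> cseries (fun n => (u n + v n)%C) (l + m)%C.
Proof. exact (@is_series_plus C_AbsRing C_NormedModule u v l m). Qed.

Lemma cseries_scal (c : C) (u : nat -> C) (l : C) :
  cseries u l -> cseries (fun n => (c * u n)%C) (c * l)%C.
Proof. exact (@is_series_scal C_AbsRing C_NormedModule c u l). Qed.

Lemma cseries_minus (u v : nat -> C) (l m : C) :
  cseries u l -> cseries v m -> cseries (fun n => (u n - v n)%C) (l - m)%C.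
Proof. exact (@is_series_minus C_AbsRing C_NormedModule u v l m). Qed.

Lemma cseries_unique (u : nat -> C) (l m : C) : cseries u l -> cseries u m -> l = m.
Proof.
intros Hl Hm.
exact (@filterlim_locally_unique _ C_AbsRing C_NormedModule eventually _ _ _ _ Hl Hm).
Qed.

Lemma cseries_shift (u : nat -> C) (l : C) :
  cseries (fun n => u (S n)) l <-> cseries u (u 0%nat + l)%C.
Proof.
split; intros H.
- apply (@is_series_decr_1 C_AbsRing C_NormedModule).
  apply (eq_ind l (fun x => cseries (fun n => u (S n)) x) H).
  change (l = (u 0%nat + l + - u 0%nat)%C). cring.
- apply (@is_series_incr_1 C_AbsRing C_NormedModule).
  apply (eq_ind (u 0%nat + l)%C (fun x => cseries u x) H).
  change ((u 0%nat + l)%C = (l + u 0%nat)%C). cring.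
Qed.

Lemma cseries_abs_ex (u : nat -> C) (v : nat -> R) :
  (forall n, Cmod (u n) <= v n) -> ex_series v -> exists l, cseries u l.
Proof.
intros H Hv.
apply (@ex_series_le C_AbsRing C_CompleteNormedModule u v); [|exact Hv].
exact H.
Qed.

Lemma cseries_terms_bounded (u : nat -> C) (l : C) :
  cseries u l -> exists M, 0 < M /\ forall n, Cmod (u n) <= M.
Proof.
intros H. destruct (proj1 (cseries_eps u l) H 1 Rlt_0_1) as [N HN].
pose (M0 := sum_n (fun k => Cmod (u k)) (S N)).
assert (H0 : 0 <= M0) by (apply rsum_ge0; intros; apply Cmod_ge_0).
exists (M0 + 2). split; [lra|]. intros n.
destruct (le_lt_dec n (S N)) as [Hn|Hn].
- assert (Cmod (u n) <= M0); [|lra].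
  apply (rsum_term_le (fun k => Cmod (u k))); [intros; apply Cmod_ge_0|lia].
- destruct n as [|n]; [lia|].
  replace (u (S n)) with ((csum u (S n) - l) - (csum u n - l))%C
    by (rewrite csum_S; cring).
  assert (H1 := HN (S n) ltac:(lia)). assert (H2 := HN n ltac:(lia)).
  assert (H3 := Cmod_triangle (csum u (S n) - l) (- (csum u n - l))).
  rewrite Cmod_opp in H3. unfold Cminus at 1. lra.
Qed.

Lemma is_series_partial_le (v : nat -> R) (V : R) (n : nat) :
  (forall k, 0 <= v k) -> is_series v V -> sum_n v n <= V.
Proof.
intros Hv HV.
assert (H := is_lim_seq_le_loc (fun _ => sum_n v n) (sum_n v) (sum_n v n) V).
apply H; [exists n; intros m Hm; now apply rsum_mono| apply is_lim_seq_const | exact HV].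
Qed.

Lemma is_series_eps (v : nat -> R) (V : R) :
  is_series v V -> forall eps, 0 < eps -> exists N, forall n, (N <= n)%nat -> Rabs (sum_n v n - V) < eps.
Proof.
intros H eps Heps.
assert (H1 : is_lim_seq (sum_n v) V) by exact H.
destruct (proj2 (is_lim_seq_spec _ _) H1 (mkposreal eps Heps)) as [N HN].
exists N. exact HN.
Qed.

Lemma cseries_remainder (u : nat -> C) (l : C) (v : nat -> R) (V : R) (K : nat) :
  cseries u l -> is_series v V -> (forall n, Cmod (u n) <= v n) ->
  Cmod (l - csum u K) <= V - sum_n v K.
Proof.
intros Hu HV Huv.
assert (Hv : forall k, 0 <= v k)
  by (intros k; eapply Rle_trans; [apply Cmod_ge_0|apply Huv]).
apply le_epsilon. intros eps Heps.
destruct (proj1 (cseries_eps u l) Hu eps Heps) as [N HN].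
set (m := Nat.max N K).
assert (H1 := HN m ltac:(lia)).
assert (H2 : Cmod (csum u m - csum u K) <= sum_n v m - sum_n v K).
{ assert (HK : (K <= m)%nat) by lia. clearbody m. clear H1.
  induction HK as [|m HK IH].
  - replace (csum u K - csum u K)%C with (RtoC 0) by cring. rewrite Cmod_0. lra.
  - rewrite csum_S, rsum_S.
    replace (csum u m + u (S m) - csum u K)%C with ((csum u m - csum u K) + u (S m))%C by cring.
    eapply Rle_trans; [apply Cmod_triangle|]. specialize (Huv (S m)). lra. }
assert (H3 := is_series_partial_le v V m Hv HV).
assert (H4 := Cmod_minus_triangle l (csum u m) (csum u K)).
rewrite (Cmod_minus_sym l (csum u m)) in H4. lra.
Qed.

Lemma cseries_bound (u : nat -> C) (l : C) (v : nat -> R) (V : R) :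
  cseries u l -> is_series v V -> (forall n, Cmod (u n) <= v n) -> Cmod l <= V.
Proof.
intros Hu HV Huv.
assert (H := cseries_remainder u l v V 0 Hu HV Huv).
rewrite csum_0, rsum_0 in H. specialize (Huv 0%nat).
assert (H1 := Cmod_triangle (l - u 0%nat) (u 0%nat)).
replace (l - u 0%nat + u 0%nat)%C with l in H1 by cring. lra.
Qed.

(** Cutting the columns at [K] leaves the rows [N <= K] complete, so the two
    ways of summing differ by a sum over the rows [N > K], which is at most a
    remainder of the convergent series of absolute row sums. *)
Lemma cseries_triangle_exchange (u : nat -> nat -> C) (c : nat -> C) (s : C) :
  (forall N n, (N < n)%nat -> u N n = RtoC 0) ->
  ex_series (fun N => sum_n (fun n => Cmod (u N n)) N) ->
  cseries (fun N => csum (u N) N) s ->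
  (forall n, cseries (fun N => u N n) (c n)) ->
  cseries c s.
Proof.
intros Hzero [V HV] Hs Hc.
apply cseries_eps. intros eps Heps.
destruct (is_series_eps _ _ HV eps Heps) as [K0 HK0].
exists K0. intros K HK.
set (v := fun N => sum_n (fun n => Cmod (u N n)) N) in *.
assert (Hcols : cseries (fun N => csum (u N) K) (csum c K)).
{ clear HK. induction K as [|K IH].
  - rewrite csum_0. eapply cseries_ext; [|apply Hc]. intros N. now rewrite csum_0.
  - rewrite csum_S. eapply cseries_ext; [|apply (cseries_plus _ _ _ _ IH (Hc (S K)))].
    intros N. now rewrite csum_S. }
assert (Hd := cseries_minus _ _ _ _ Hs Hcols).
assert (Hfull : forall N K', (N <= K')%nat -> csum (u N) K' = csum (u N) N).
{ intros N K' HN. induction HN as [|K' HN IH]; [reflexivity|].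
  rewrite csum_S, IH, Hzero by lia. cring. }
assert (Hdv : forall N, Cmod (csum (u N) N - csum (u N) K) <= v N).
{ intros N. destruct (le_lt_dec N K) as [HN|HN].
  - rewrite (Hfull N K HN).
    replace (csum (u N) N - csum (u N) N)%C with (RtoC 0) by cring. rewrite Cmod_0.
    apply rsum_ge0. intros; apply Cmod_ge_0.
  - assert (H : forall m, (K <= m)%nat ->
      Cmod (csum (u N) m - csum (u N) K) <= sum_n (fun n => Cmod (u N n)) m).
    { intros m Hm. induction Hm as [|m Hm IH].
      - replace (csum (u N) K - csum (u N) K)%C with (RtoC 0) by cring. rewrite Cmod_0.
        apply rsum_ge0. intros; apply Cmod_ge_0.
      - rewrite csum_S, rsum_S.
        replace (csum (u N) m + u N (S m) - csum (u N) K)%C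
          with ((csum (u N) m - csum (u N) K) + u N (S m))%C by cring.
        eapply Rle_trans; [apply Cmod_triangle|]. lra. }
    apply H. lia. }
assert (Hrem := cseries_remainder _ _ v V K Hd HV Hdv).
change (Cmod (s - csum c K - csum (fun N => (csum (u N) N - csum (u N) K)%C) K)
        <= V - sum_n v K) in Hrem.
rewrite (csum_zero (fun N => (csum (u N) N - csum (u N) K)%C) K) in Hrem.
2:{ intros N HN. rewrite (Hfull N K HN). cring. }
specialize (HK0 K HK).
rewrite Cmod_minus_sym.
replace (s - csum c K - RtoC 0)%C with (s - csum c K)%C in Hrem by cring.
apply Rle_lt_trans with (1 := Hrem).
rewrite Rabs_minus_sym in HK0. apply Rabs_lt_between in HK0. lra.
Qed.

(** * Power series and their recentring *)

Definition psum (a : nat -> C) (z l : C) : Prop :=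
  cseries (fun n => (a n * z ^ n)%C) l.

(** This is the form in which a lower bound [r] for the radius of convergence is
    carried through the proof; [M] keeps track of uniformity. *)
Definition majorized (a : nat -> C) (M r : R) : Prop :=
  forall n, Cmod (a n) * r ^ n <= M.

Lemma is_pseries_psum (a : nat -> C) (z l : C) :
  @is_pseries C_AbsRing C_NormedModule a z l <-> psum a z l.
Proof.
assert (Hpow : forall n, @pow_n C_Ring z n = (z ^ n)%C).
{ induction n as [|n IH]; [reflexivity|].
  rewrite Cpow_S, <- IH. reflexivity. }
assert (Hterm : forall n, (a n * z ^ n)%C =
  @scal C_AbsRing C_NormedModule (@pow_n C_AbsRing z n) (a n)).
{ intros n. rewrite <- Hpow. apply Cmult_comm. }
unfold is_pseries, psum.
split; apply cseries_ext; intros n; [symmetry|]; apply Hterm.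
Qed.

Lemma majorized_geom (a : nat -> C) (M rho r : R) :
  majorized a M rho -> 0 <= r < rho ->
  forall n, Cmod (a n) * r ^ n <= M * (r / rho) ^ n.
Proof.
intros H Hr n.
replace (Cmod (a n) * r ^ n) with (Cmod (a n) * rho ^ n * (r / rho) ^ n).
- apply Rmult_le_compat_r; [|apply H].
  apply pow_le, Rdiv_le_0_compat; lra.
- unfold Rdiv. rewrite Rpow_mult_distr, pow_inv. field. apply pow_nonzero. lra.
Qed.

Lemma geom_series (M q : R) : 0 <= q < 1 -> is_series (fun n => M * q ^ n) (M / (1 - q)).
Proof.
intros Hq. apply (is_series_scal (K:=R_AbsRing) (V:=R_NormedModule) M (fun n => q ^ n) (/ (1 - q))).
apply is_series_geom. rewrite Rabs_pos_eq; lra.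
Qed.

Lemma ratio_bounds (r rho : R) : 0 <= r < rho -> 0 <= r / rho < 1.
Proof.
intros H. split; [apply Rdiv_le_0_compat; lra|].
apply (Rmult_lt_reg_r rho); [lra|]. field_simplify; lra.
Qed.

Lemma majorized_summable (a : nat -> C) (M rho r : R) :
  majorized a M rho -> 0 <= r < rho -> ex_series (fun n => Cmod (a n) * r ^ n).
Proof.
intros H Hr.
apply (@ex_series_le R_AbsRing R_CompleteNormedModule _ (fun n => M * (r / rho) ^ n)).
- intros n. change (Rabs (Cmod (a n) * r ^ n) <= M * (r / rho) ^ n).
  rewrite Rabs_pos_eq; [now apply majorized_geom|].
  apply Rmult_le_pos; [apply Cmod_ge_0|apply pow_le; lra].
- exists (M / (1 - r / rho)). apply geom_series. now apply ratio_bounds.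
Qed.

Lemma Cmod_term (a : nat -> C) (z : C) (n : nat) :
  Cmod (a n * z ^ n) = Cmod (a n) * Cmod z ^ n.
Proof. now rewrite Cmod_mult, Cmod_pow. Qed.

Lemma psum_ex (a : nat -> C) (M rho : R) (z : C) :
  majorized a M rho -> Cmod z < rho -> exists l, psum a z l.
Proof.
intros H Hz. apply cseries_abs_ex with (fun n => Cmod (a n) * Cmod z ^ n).
- intros n. rewrite Cmod_term. lra.
- apply majorized_summable with M rho; [exact H|]. split; [apply Cmod_ge_0|exact Hz].
Qed.

Lemma psum_majorized (a : nat -> C) (z l : C) :
  psum a z l -> exists M, 0 < M /\ majorized a M (Cmod z).
Proof.
intros H. destruct (cseries_terms_bounded _ _ H) as [M [HM0 HM]].
exists M. split; [exact HM0|]. intros n. specialize (HM n). now rewrite Cmod_term in HM.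
Qed.

Lemma psum_unique (a : nat -> C) (z l m : C) : psum a z l -> psum a z m -> l = m.
Proof. apply cseries_unique. Qed.

Lemma psum_0 (a : nat -> C) : psum a (RtoC 0) (a 0%nat).
Proof.
unfold psum. replace (a 0%nat) with (a 0%nat * (RtoC 0) ^ 0 + RtoC 0)%C by (simpl; cring).
apply (cseries_shift (fun n => (a n * RtoC 0 ^ n)%C)).
apply cseries_eps. intros eps Heps. exists 0%nat. intros n _.
rewrite csum_zero; [|intros k _; rewrite Cpow_S; cring].
replace (RtoC 0 - RtoC 0)%C with (RtoC 0) by cring. now rewrite Cmod_0.
Qed.

(** Pascal's recursion, with [binom n k = 0] for [k > n]: these zeros allow
    the columns of the double series in [recentre] to be indexed from zero. *)
Fixpoint binom (n k : nat) : nat :=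
  match n, k with
  | _, 0%nat => 1%nat
  | 0%nat, S _ => 0%nat
  | S n', S k' => (binom n' (S k') + binom n' k')%nat
  end.

Lemma binom_0 (n : nat) : binom n 0 = 1%nat.
Proof. now destruct n. Qed.

Lemma binom_lt (n k : nat) : (n < k)%nat -> binom n k = 0%nat.
Proof.
revert k. induction n as [|n IH]; intros [|k] H; try lia; [reflexivity|].
simpl. rewrite !IH by lia. reflexivity.
Qed.

Lemma binom_1 (n : nat) : binom n 1 = n.
Proof. induction n as [|n IH]; [reflexivity|]. simpl. rewrite IH, binom_0. lia. Qed.

Definition binomial_term (x y : C) (N n : nat) : C :=
  (RtoC (INR (binom N n)) * x ^ (N - n) * y ^ n)%C.

Lemma binomial_term_lt (x y : C) (N n : nat) : (N < n)%nat -> binomial_term x y N n = RtoC 0.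
Proof. intros H. unfold binomial_term. rewrite (binom_lt N n H). simpl. cring. Qed.

Lemma binomial_term_S (x y : C) (N n : nat) :
  binomial_term x y (S N) (S n) = (x * binomial_term x y N (S n) + y * binomial_term x y N n)%C.
Proof.
unfold binomial_term.
change (binom (S N) (S n)) with (binom N (S n) + binom N n)%nat.
rewrite plus_INR, RtoC_plus, Cpow_S. replace (S N - S n)%nat with (N - n)%nat by lia.
destruct (le_lt_dec (S n) N) as [H|H].
- replace (N - n)%nat with (S (N - S n)) by lia. rewrite Cpow_S. cring.
- rewrite (binom_lt N (S n) H). simpl (INR 0). cring.
Qed.

Lemma binomial_theorem (x y : C) (N : nat) : csum (binomial_term x y N) N = ((x + y) ^ N)%C.
Proof.
induction N as [|N IH].
- rewrite csum_0. unfold binomial_term. simpl. cring.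
- rewrite csum_shift.
  rewrite (csum_ext _ (fun n => (x * binomial_term x y N (S n) + y * binomial_term x y N n)%C))
    by (intros; apply binomial_term_S).
  rewrite csum_plus, !csum_mult_l, IH, Cpow_S.
  assert (H : csum (fun n => binomial_term x y N (S n)) N =
    ((x + y) ^ N - binomial_term x y N 0)%C).
  { assert (H1 := csum_shift (binomial_term x y N) N).
    rewrite csum_S, IH, binomial_term_lt in H1 by lia.
    replace ((x + y) ^ N)%C with ((x + y) ^ N + RtoC 0)%C by cring.
    rewrite H1. cring. }
  rewrite H.
  replace (binomial_term x y (S N) 0) with (x * binomial_term x y N 0)%C.
  + cring.
  + unfold binomial_term. rewrite !binom_0, !Nat.sub_0_r, Cpow_S. cring.
Qed.

Definition rbinomial_term (x y : R) (N n : nat) : R :=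
  INR (binom N n) * x ^ (N - n) * y ^ n.

Lemma rbinomial_theorem (x y : R) (N : nat) : sum_n (rbinomial_term x y N) N = (x + y) ^ N.
Proof.
apply RtoC_inj. rewrite <- csum_RtoC, RtoC_pow, RtoC_plus, <- binomial_theorem.
apply csum_ext. intros n _. unfold rbinomial_term, binomial_term.
now rewrite !RtoC_mult, !RtoC_pow.
Qed.

Lemma rbinomial_term_ge0 (x y : R) (N n : nat) :
  0 <= x -> 0 <= y -> 0 <= rbinomial_term x y N n.
Proof.
intros Hx Hy. unfold rbinomial_term.
repeat apply Rmult_le_pos; [apply pos_INR|apply pow_le; lra|apply pow_le; lra].
Qed.

Lemma rbinomial_term_le (x y : R) (N n : nat) :
  0 <= x -> 0 <= y -> rbinomial_term x y N n <= (x + y) ^ N.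
Proof.
intros Hx Hy. destruct (le_lt_dec n N) as [H|H].
- rewrite <- rbinomial_theorem. apply rsum_term_le; [|exact H].
  intros; now apply rbinomial_term_ge0.
- unfold rbinomial_term. rewrite (binom_lt N n H). simpl.
  assert (0 <= (x + y) ^ N) by (apply pow_le; lra). lra.
Qed.

Lemma Cmod_binomial_term (x y : C) (N n : nat) :
  Cmod (binomial_term x y N n) = rbinomial_term (Cmod x) (Cmod y) N n.
Proof.
unfold binomial_term, rbinomial_term.
rewrite !Cmod_mult, !Cmod_pow, Cmod_R, Rabs_pos_eq by apply pos_INR. reflexivity.
Qed.

(** Summing over [N] gives the [n]-th Taylor coefficient at [z0] of the sum of the
    power series [a]; the first [n] terms are zero. *)
Definition recentred_term (a : nat -> C) (z0 : C) (n N : nat) : C :=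
  (a N * (RtoC (INR (binom N n)) * z0 ^ (N - n)))%C.

(** Expanding each [(z0 + h)^N] by the binomial theorem yields a triangular double
    series, absolutely convergent since its absolute row sums are
    [|a_N| (|z0| + |h|)^N].  The coefficients are defined as its column sums. *)
Lemma recentre (a : nat -> C) (M rho : R) (z0 : C) :
  majorized a M rho -> Cmod z0 < rho ->
  exists b : nat -> C,
    (forall n, cseries (recentred_term a z0 n) (b n)) /\
    (forall d, 0 <= d -> Cmod z0 + d < rho ->
       majorized b (M / (1 - (Cmod z0 + d) / rho)) d) /\
    (forall h s, Cmod z0 + Cmod h < rho -> psum a (z0 + h) s -> psum b h s).
Proof.
intros Ha Hz0. assert (Hz0' := Cmod_ge_0 z0).
assert (Hterm : forall d n N, 0 <= d ->
  Cmod (recentred_term a z0 n N) * d ^ n <= Cmod (a N) * (Cmod z0 + d) ^ N).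
{ intros d n N Hd. unfold recentred_term.
  rewrite !Cmod_mult, Cmod_pow, Cmod_R, Rabs_pos_eq by apply pos_INR.
  rewrite Rmult_assoc. apply Rmult_le_compat_l; [apply Cmod_ge_0|].
  now apply rbinomial_term_le. }
assert (Hex : forall n, exists l, cseries (recentred_term a z0 n) l).
{ intros n. set (d := (rho - Cmod z0) / 2).
  assert (Hd : 0 < d) by (unfold d; lra).
  apply cseries_abs_ex with (fun N => / d ^ n * (Cmod (a N) * (Cmod z0 + d) ^ N)).
  - intros N. assert (Hdn : 0 < d ^ n) by now apply pow_lt.
    apply (Rmult_le_reg_r (d ^ n)); [exact Hdn|].
    replace (/ d ^ n * (Cmod (a N) * (Cmod z0 + d) ^ N) * d ^ n)
      with (Cmod (a N) * (Cmod z0 + d) ^ N) by (field; lra).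
    apply Hterm; lra.
  - apply (@ex_series_scal R_AbsRing R_NormedModule).
    apply majorized_summable with M rho; [exact Ha|]. unfold d; lra. }
exists (fun n => @iota C_CompleteNormedModule (cseries (recentred_term a z0 n))).
assert (Hb : forall n, cseries (recentred_term a z0 n)
  (@iota C_CompleteNormedModule (cseries (recentred_term a z0 n)))).
{ intros n. destruct (Hex n) as [l Hl].
  apply (@iota_correct C_AbsRing C_CompleteNormedModule).
  exists l. split; [exact Hl|]. intros y Hy. now apply cseries_unique with (1 := Hl). }
split; [exact Hb|]. split.
- intros d Hd Hd2 n.
  assert (H := cseries_scal (RtoC (d ^ n)) _ _ (Hb n)).
  assert (Hdn : 0 <= d ^ n) by now apply pow_le.
  replace (Cmod _ * d ^ n) with (Cmod (RtoC (d ^ n) *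
    @iota C_CompleteNormedModule (cseries (recentred_term a z0 n)))).
  2:{ rewrite Cmod_mult, Cmod_R, Rabs_pos_eq by exact Hdn. apply Rmult_comm. }
  apply (cseries_bound _ _ (fun N => M * ((Cmod z0 + d) / rho) ^ N) _ H).
  + apply geom_series. apply ratio_bounds. lra.
  + intros N. rewrite Cmod_mult, Cmod_R, Rabs_pos_eq, Rmult_comm by exact Hdn.
    eapply Rle_trans; [apply Hterm; exact Hd|].
    apply majorized_geom; [exact Ha|lra].
- intros h s Hh Hs.
  assert (Hu : forall N n, (a N * binomial_term z0 h N n)%C = (h ^ n * recentred_term a z0 n N)%C).
  { intros N n. unfold binomial_term, recentred_term. cring. }
  apply (cseries_triangle_exchange (fun N n => (a N * binomial_term z0 h N n)%C)).
  + intros N n HN. rewrite binomial_term_lt by exact HN. cring.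
  + apply (ex_series_ext (fun N => Cmod (a N) * (Cmod z0 + Cmod h) ^ N)).
    * intros N. rewrite <- rbinomial_theorem, <- rsum_mult_l. apply rsum_ext.
      intros n _. now rewrite Cmod_mult, Cmod_binomial_term.
    * apply majorized_summable with M rho; [exact Ha|].
      assert (H := Cmod_ge_0 h). lra.
  + apply cseries_ext with (2 := Hs). intros N.
    now rewrite csum_mult_l, binomial_theorem.
  + intros n. replace (@iota C_CompleteNormedModule (cseries (recentred_term a z0 n)) * h ^ n)%C
      with (h ^ n * @iota C_CompleteNormedModule (cseries (recentred_term a z0 n)))%C by cring.
    apply cseries_ext with (2 := cseries_scal (h ^ n)%C _ _ (Hb n)).
    intros N. symmetry. apply Hu.
Qed.

(** * Parseval's inequality and Cauchy's estimate *)

Definition cis (t : R) : C := (cos t, sin t).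

Lemma cis_pow (t : R) (n : nat) : (cis t ^ n)%C = cis (INR n * t).
Proof.
induction n as [|n IH].
- unfold cis. simpl. rewrite Rmult_0_l, cos_0, sin_0. reflexivity.
- rewrite Cpow_S, IH, S_INR. unfold cis.
  replace ((INR n + 1) * t) with (t + INR n * t) by ring.
  rewrite cos_plus, sin_plus. unfold Cmult; simpl. f_equal; ring.
Qed.

Lemma Cmod_cis (t : R) : Cmod (cis t) = 1.
Proof.
unfold Cmod, cis, fst, snd. rewrite <- !Rsqr_pow2, Rplus_comm, sin2_cos2. apply sqrt_1.
Qed.

Lemma cis_neq_1 (t : R) : 0 < t < 2 * PI -> cis t <> RtoC 1.
Proof.
intros Ht H. apply (f_equal fst) in H. simpl in H.
replace t with (2 * (t / 2)) in H by field. rewrite cos_2a_sin in H.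
assert (0 < sin (t / 2)) by (apply sin_gt_0; lra). nra.
Qed.

Lemma geom_sum (q : C) (n : nat) : ((q - RtoC 1) * csum (fun j => q ^ j) n)%C = (q ^ S n - RtoC 1)%C.
Proof.
induction n as [|n IH].
- rewrite csum_0. simpl. cring.
- rewrite csum_S, Cmult_plus_distr_l, IH, !Cpow_S. cring.
Qed.

Definition root_of_unity (M : nat) : C := cis (2 * PI / INR (S M)).

(** A geometric sum with ratio [q <> 1] such that [q^(M+1) = 1]. *)
Lemma roots_sum_0 (M d : nat) :
  (0 < d <= M)%nat -> csum (fun j => ((root_of_unity M ^ j) ^ d)%C) M = RtoC 0.
Proof.
intros Hd. assert (HM := lt_0_INR (S M) ltac:(lia)). assert (HPI := PI_RGT_0).
set (q := (root_of_unity M ^ d)%C).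
rewrite (csum_ext _ (fun j => (q ^ j)%C)).
2:{ intros j _. unfold q. now rewrite <- !Cpow_mult_r, Nat.mul_comm. }
assert (Hq1 : q <> RtoC 1).
{ unfold q, root_of_unity. rewrite cis_pow. apply cis_neq_1.
  assert (H1 := lt_0_INR d ltac:(lia)). assert (H2 := lt_INR d (S M) ltac:(lia)).
  split.
  - apply Rmult_lt_0_compat; [exact H1|]. apply Rdiv_lt_0_compat; lra.
  - apply (Rmult_lt_reg_r (INR (S M))); [exact HM|]. field_simplify; [|lra]. nra. }
assert (HqM : (q ^ S M)%C = RtoC 1).
{ unfold q, root_of_unity.
  rewrite <- Cpow_mult_r, Nat.mul_comm, Cpow_mult_r, (cis_pow _ (S M)).
  replace (INR (S M) * (2 * PI / INR (S M))) with (2 * PI) by (field; lra).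
  unfold cis. rewrite cos_2PI, sin_2PI. apply Cpow_1_l. }
assert (H := geom_sum q M). rewrite HqM in H.
destruct (Ceq_dec (csum (fun j => (q ^ j)%C) M) (RtoC 0)) as [H0|H0]; [exact H0|].
exfalso. apply (Cmult_neq_0 (q - RtoC 1) (csum (fun j => (q ^ j)%C) M)); [|exact H0|].
- intros E. apply Hq1. replace q with (q - RtoC 1 + RtoC 1)%C by cring. rewrite E. cring.
- rewrite H. cring.
Qed.

Definition cpoly (c : nat -> C) (n : nat) (z : C) : C := csum (fun k => (c k * z ^ k)%C) n.

Lemma unimodular_pow_conj (z : C) (j k : nat) :
  Cmod z = 1 -> (j <= k)%nat -> (z ^ k * Cconj (z ^ j) = z ^ (k - j))%C.
Proof.
intros Hz H. replace (z ^ k)%C with (z ^ (k - j) * z ^ j)%C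
  by (rewrite <- Cpow_add_r; f_equal; lia).
rewrite <- Cmult_assoc, <- Cmod2_conj, Cmod_pow, Hz, pow1.
replace (RtoC (1 ^ 2)) with (RtoC 1) by (f_equal; ring). cring.
Qed.

Lemma monomial_orthogonal (c : nat -> C) (M L K : nat) :
  (L < K <= M)%nat ->
  csum (fun j => ((root_of_unity M ^ j) ^ K * Cconj (cpoly c L (root_of_unity M ^ j)))%C) M
    = RtoC 0.
Proof.
intros HLK.
assert (Hterm : forall l, (l < K)%nat ->
  csum (fun j => ((root_of_unity M ^ j) ^ K *
    Cconj (c l * (root_of_unity M ^ j) ^ l))%C) M = RtoC 0).
{ intros l Hl.
  rewrite (csum_ext _ (fun j => (Cconj (c l) * (root_of_unity M ^ j) ^ (K - l))%C)).
  - rewrite csum_mult_l, roots_sum_0 by lia. cring.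
  - intros j _. rewrite Cmult_conj, <- (unimodular_pow_conj _ l K); [cring| |lia].
    rewrite Cmod_pow. unfold root_of_unity. now rewrite Cmod_cis, pow1. }
induction L as [|L IH].
- rewrite <- (Hterm 0%nat) by lia. apply csum_ext. intros j _. unfold cpoly. now rewrite csum_0.
- rewrite (csum_ext _ (fun j =>
    ((root_of_unity M ^ j) ^ K * Cconj (cpoly c L (root_of_unity M ^ j)) +
     (root_of_unity M ^ j) ^ K * Cconj (c (S L) * (root_of_unity M ^ j) ^ (S L)))%C)).
  + rewrite csum_plus, IH, Hterm by lia. cring.
  + intros j _. unfold cpoly. rewrite csum_S, Cplus_conj. cring.
Qed.

Lemma Cmod2_plus (x y : C) : Cmod (x + y) ^ 2 = Cmod x ^ 2 + Cmod y ^ 2 + 2 * Re (y * Cconj x).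
Proof. rewrite !Cmod2_alt. destruct x, y; simpl. ring. Qed.

Lemma Re_csum (u : nat -> C) (n : nat) : Re (csum u n) = sum_n (fun k => Re (u k)) n.
Proof.
induction n as [|n IH].
- now rewrite csum_0, rsum_0.
- rewrite csum_S, rsum_S, <- IH. reflexivity.
Qed.

(** The mean of [|P|^2] over the [M + 1]-st roots of unity is the squared l2-norm of
    the coefficients.  Adding one monomial at a time, the cross term has mean
    zero by [monomial_orthogonal] as long as the degree is at most [M]. *)
Lemma parseval_roots (c : nat -> C) (M K : nat) :
  (K <= M)%nat ->
  sum_n (fun j => Cmod (cpoly c K (root_of_unity M ^ j)) ^ 2) M =
  INR (S M) * sum_n (fun k => Cmod (c k) ^ 2) K.
Proof.
assert (Hmod : forall j k, Cmod ((root_of_unity M ^ j) ^ k) = 1)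
  by (intros; rewrite !Cmod_pow; unfold root_of_unity; now rewrite Cmod_cis, !pow1).
intros HK. induction K as [|K IH].
- rewrite rsum_0, <- sum_n_const. apply rsum_ext. intros j _.
  unfold cpoly. rewrite csum_0, Cmod_mult, Hmod. ring.
- rewrite rsum_S, Rmult_plus_distr_l, <- IH by lia.
  assert (H := monomial_orthogonal c M K (S K) ltac:(lia)).
  rewrite (rsum_ext _ (fun j => (Cmod (cpoly c K (root_of_unity M ^ j)) ^ 2 + Cmod (c (S K)) ^ 2) +
    2 * Re (c (S K) * ((root_of_unity M ^ j) ^ S K * Cconj (cpoly c K (root_of_unity M ^ j)))))).
  + rewrite !rsum_plus, sum_n_const, rsum_mult_l, <- Re_csum, csum_mult_l, H.
    replace (c (S K) * RtoC 0)%C with (RtoC 0) by cring. simpl Re. lra.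
  + intros j _. unfold cpoly at 1. rewrite csum_S, Cmod2_plus.
    rewrite Cmod_mult, Hmod, Rmult_1_r, Cmult_assoc. reflexivity.
Qed.

Lemma cpoly_coef_bound (c : nat -> C) (M : nat) (B : R) :
  (forall z, Cmod z = 1 -> Cmod (cpoly c M z) <= B) ->
  sum_n (fun k => Cmod (c k) ^ 2) M <= B ^ 2.
Proof.
intros H. assert (HM := lt_0_INR (S M) ltac:(lia)).
apply (Rmult_le_reg_l (INR (S M))); [exact HM|].
rewrite <- parseval_roots by lia. rewrite <- sum_n_const.
apply rsum_le. intros j _. apply pow_incr. split; [apply Cmod_ge_0|].
apply H. rewrite Cmod_pow. unfold root_of_unity. now rewrite Cmod_cis, pow1.
Qed.

(** The polynomial case is applied to long partial sums, which on [|z| = r] are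
    bounded by [B] up to a uniform remainder. *)
Lemma psum_parseval (a : nat -> C) (M rho r B : R) :
  majorized a M rho -> 0 <= r < rho ->
  (forall z, Cmod z = r -> exists s, psum a z s /\ Cmod s <= B) ->
  forall K, sum_n (fun k => (Cmod (a k) * r ^ k) ^ 2) K <= B ^ 2.
Proof.
intros Ha Hr HB K.
assert (HB0 : 0 <= B).
{ destruct (HB (RtoC r)) as [s [_ Hs]]; [rewrite Cmod_R; apply Rabs_pos_eq; lra|].
  assert (H := Cmod_ge_0 s). lra. }
destruct (majorized_summable a M rho r Ha Hr) as [V HV].
assert (Hv0 : forall n, 0 <= Cmod (a n) * r ^ n)
  by (intros; apply Rmult_le_pos; [apply Cmod_ge_0|apply pow_le; lra]).
assert (Hmain : forall eps, 0 < eps ->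
  sum_n (fun k => (Cmod (a k) * r ^ k) ^ 2) K <= (B + eps) ^ 2).
{ intros eps Heps. destruct (is_series_eps _ _ HV eps Heps) as [N HN].
  set (m := Nat.max N K).
  apply Rle_trans with (sum_n (fun k => (Cmod (a k) * r ^ k) ^ 2) m).
  { apply rsum_mono; [intros; apply pow2_ge_0|lia]. }
  rewrite (rsum_ext _ (fun k => Cmod (a k * RtoC r ^ k) ^ 2)).
  2:{ intros k _. rewrite Cmod_term, Cmod_R, (Rabs_pos_eq r) by lra. reflexivity. }
  apply (cpoly_coef_bound (fun k => (a k * RtoC r ^ k)%C)). intros z Hz.
  destruct (HB (RtoC r * z)%C) as [s [Hs HsB]].
  { rewrite Cmod_mult, Hz, Cmod_R, Rabs_pos_eq; lra. }
  assert (Hrem := cseries_remainder _ s _ V m Hs HV).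
  assert (Hterm : forall n, Cmod (a n * (RtoC r * z) ^ n) <= Cmod (a n) * r ^ n).
  { intros n. rewrite Cmod_term, Cmod_mult, Hz, Cmod_R, Rabs_pos_eq, Rmult_1_r; lra. }
  specialize (Hrem Hterm). specialize (HN m ltac:(lia)).
  assert (H1 := is_series_partial_le _ _ m Hv0 HV).
  apply Rabs_lt_between in HN.
  unfold cpoly.
  rewrite (csum_ext _ (fun n => (a n * (RtoC r * z) ^ n)%C))
    by (intros; rewrite Cpow_mult_l; cring).
  set (q := csum _ m) in *.
  assert (H2 := Cmod_minus_triangle q s (RtoC 0)).
  rewrite (Cmod_minus_sym q s) in H2.
  replace (q - RtoC 0)%C with q in H2 by cring.
  replace (s - RtoC 0)%C with s in H2 by cring. lra. }
apply le_epsilon. intros eps Heps.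
set (t := Rmin 1 (eps / (2 * B + 1))).
assert (Ht : 0 < t) by (apply Rmin_pos; [lra|apply Rdiv_lt_0_compat; lra]).
assert (Ht1 : t <= 1) by apply Rmin_l.
assert (Ht2 : t * (2 * B + 1) <= eps).
{ apply Rle_trans with (eps / (2 * B + 1) * (2 * B + 1)).
  - apply Rmult_le_compat_r; [lra|apply Rmin_r].
  - right. field. lra. }
specialize (Hmain t Ht). nra.
Qed.

Lemma psum_cauchy (a : nat -> C) (M rho r B : R) :
  majorized a M rho -> 0 <= r < rho ->
  (forall z, Cmod z = r -> exists s, psum a z s /\ Cmod s <= B) ->
  majorized a B r.
Proof.
intros Ha Hr HB n.
assert (HB0 : 0 <= B).
{ destruct (HB (RtoC r)) as [s [_ Hs]]; [rewrite Cmod_R; apply Rabs_pos_eq; lra|].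
  assert (H := Cmod_ge_0 s). lra. }
apply Rsqr_incr_0_var; [|exact HB0].
rewrite !Rsqr_pow2.
eapply Rle_trans; [|apply (psum_parseval a M rho r B Ha Hr HB n)].
apply (rsum_term_le (fun k => (Cmod (a k) * r ^ k) ^ 2)); [|lia].
intros; apply pow2_ge_0.
Qed.

(** Cauchy's estimate with the bound zero. *)
Lemma psum_coef_unique (a b : nat -> C) (d : R) :
  0 < d -> (forall h, Cmod h < d -> exists s, psum a h s /\ psum b h s) ->
  forall n, a n = b n.
Proof.
intros Hd H n.
assert (Hhalf : forall t, 0 < t < d -> Cmod (RtoC t) = t /\ Cmod (RtoC t) < d)
  by (intros t Ht; rewrite Cmod_R, Rabs_pos_eq; lra).
assert (Hdiff : forall h, Cmod h < d -> psum (fun k => (a k - b k)%C) h (RtoC 0)).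
{ intros h Hh. destruct (H h Hh) as [s [Ha Hb]].
  replace (RtoC 0) with (s - s)%C by cring.
  eapply cseries_ext; [|apply (cseries_minus _ _ _ _ Ha Hb)].
  intros k. cring. }
destruct (Hhalf (d / 2) ltac:(lra)) as [E1 E2].
destruct (psum_majorized _ _ _ (Hdiff _ E2)) as [M [_ HM]]. rewrite E1 in HM.
assert (Hr : 0 <= d / 4 < d / 2) by lra.
assert (Hc := psum_cauchy _ M (d / 2) (d / 4) 0 HM Hr).
assert (Hz : majorized (fun k => (a k - b k)%C) 0 (d / 4)).
{ apply Hc. intros z Hz. exists (RtoC 0). split; [apply Hdiff; lra|rewrite Cmod_0; lra]. }
specialize (Hz n). assert (Hp : 0 < (d / 4) ^ n) by (apply pow_lt; lra).
assert (Hm := Cmod_ge_0 (a n - b n)).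
assert (H0 : Cmod (a n - b n) = 0) by nra.
apply Cmod_eq_0 in H0.
replace (a n) with (a n - b n + b n)%C by cring. rewrite H0. cring.
Qed.

(** * Analytic functions on the disk are power series *)

Definition expands (f : C -> C) (z0 : C) (a : nat -> C) (d : R) : Prop :=
  forall h, Cmod h < d -> psum a h (f (z0 + h)%C).

Lemma analytic_at_expands (f : C -> C) (z0 : C) :
  analytic_at f z0 <-> exists a d, 0 < d /\ expands f z0 a d.
Proof.
split.
- intros [a [r H]]. exists a, r. split; [apply cond_pos|].
  intros h Hh. apply is_pseries_psum.
  assert (E : (z0 + h - z0)%C = h) by cring.
  specialize (H (z0 + h)%C). rewrite E in H. apply H. exact Hh.
- intros [a [d [Hd H]]]. exists a, (mkposreal d Hd). intros z Hz.
  apply is_pseries_psum. specialize (H (z - z0)%C Hz).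
  replace (z0 + (z - z0))%C with z in H by cring. exact H.
Qed.

Lemma majorized_le (a : nat -> C) (M M' r r' : R) :
  majorized a M r -> 0 <= r' <= r -> M <= M' -> majorized a M' r'.
Proof.
intros H Hr HM n. specialize (H n).
assert (Cmod (a n) * r' ^ n <= Cmod (a n) * r ^ n); [|lra].
apply Rmult_le_compat_l; [apply Cmod_ge_0|]. apply pow_incr. lra.
Qed.

Lemma expands_majorized (f : C -> C) (z0 : C) (a : nat -> C) (d r : R) :
  expands f z0 a d -> 0 <= r < d -> exists M, 0 < M /\ majorized a M r.
Proof.
intros H Hr.
assert (E : Cmod (RtoC r) = r) by (rewrite Cmod_R; apply Rabs_pos_eq; lra).
destruct (psum_majorized a (RtoC r) (f (z0 + RtoC r)%C)) as [M HM].
- apply H. lra.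
- rewrite E in HM. now exists M.
Qed.

(** A single number [d] controls both the radius of the expansion and the size of
    its coefficients, and smaller values of [d] are weaker: this makes the
    condition suitable for a compactness argument. *)
Definition uniformly_expands (f : C -> C) (d : R) (z : C) : Prop :=
  exists b, expands f z b d /\ majorized b (/ d) d.

Lemma uniformly_expands_le (f : C -> C) (d d' : R) (z : C) :
  0 < d' <= d -> uniformly_expands f d z -> uniformly_expands f d' z.
Proof.
intros Hd [b [Hb HM]]. exists b. split.
- intros h Hh. apply Hb. lra.
- apply majorized_le with (1 := HM); [lra|]. apply Rinv_le_contravar; lra.
Qed.

Lemma expands_recentre (f : C -> C) (a : nat -> C) (z0 : C) (d M rho : R) (w : C) :
  expands f z0 a d -> majorized a M rho -> rho <= d -> Cmod w < rho ->
  exists b, (forall n, cseries (recentred_term a w n) (b n)) /\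
    expands f (z0 + w)%C b (rho - Cmod w) /\
    (forall r, 0 <= r -> Cmod w + r < rho ->
       majorized b (M / (1 - (Cmod w + r) / rho)) r).
Proof.
intros Hf Ha Hrho Hw.
destruct (recentre a M rho w Ha Hw) as [b [Hb [HM Hsum]]].
exists b. split; [exact Hb|split; [|exact HM]].
intros h Hh. apply Hsum; [lra|].
rewrite <- Cplus_assoc. apply Hf.
eapply Rle_lt_trans; [apply Cmod_triangle|]. lra.
Qed.

(** Recentring the expansion at [z0] gives expansions at all nearby points with
    the same bound. *)
Lemma uniformly_expands_near (f : C -> C) (z0 : C) :
  analytic_at f z0 ->
  exists d, 0 < d /\ forall z, Cmod (z - z0) < 2 * d -> uniformly_expands f d z.
Proof.
intros H. apply analytic_at_expands in H. destruct H as [a [D [HD H]]].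
set (rho := D / 2). assert (Hrho : 0 < rho) by (unfold rho; lra).
destruct (expands_majorized f z0 a D rho H ltac:(unfold rho; lra)) as [M [HM0 HM]].
set (d := Rmin (rho / 8) (/ (2 * M))).
assert (Hd : 0 < d) by (apply Rmin_pos; [lra|apply Rinv_0_lt_compat; lra]).
assert (Hd1 : d <= rho / 8) by apply Rmin_l.
assert (Hd2 : 2 * M <= / d).
{ rewrite <- (Rinv_inv (2 * M)). apply Rinv_le_contravar; [exact Hd|apply Rmin_r]. }
exists d. split; [exact Hd|]. intros z Hz.
destruct (expands_recentre f a z0 D M rho (z - z0) H HM) as [b [_ [Hb1 Hb2]]];
  [unfold rho; lra|lra|].
replace (z0 + (z - z0))%C with z in Hb1 by cring.
exists b. split.
- intros h Hh. apply Hb1. lra.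
- apply majorized_le with (1 := Hb2 (rho / 4) ltac:(lra) ltac:(lra)); [lra|].
  apply Rle_trans with (2 * M); [|exact Hd2].
  assert (Hq : (Cmod (z - z0) + rho / 4) / rho <= / 2).
  { apply (Rmult_le_reg_r rho); [exact Hrho|]. field_simplify; lra. }
  set (q := (Cmod (z - z0) + rho / 4) / rho) in *.
  apply (Rmult_le_reg_r (1 - q)); [lra|]. field_simplify; [|lra]. nra.
Qed.

Lemma Cmod_le_Re_Im (z : C) : Cmod z <= Rabs (Re z) + Rabs (Im z).
Proof.
replace z with (RtoC (Re z) + Ci * RtoC (Im z))%C at 1.
- eapply Rle_trans; [apply Cmod_triangle|].
  rewrite Cmod_mult, Cmod_Ci, !Cmod_R. lra.
- destruct z as [x y]. unfold Cplus, Cmult, Ci, RtoC, Re, Im; simpl. f_equal; ring.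
Qed.

Lemma Rabs_Re_le (z : C) : Rabs (Re z) <= Cmod z.
Proof. eapply Rle_trans; [apply Rmax_l|apply Rmax_Cmod]. Qed.

Lemma Rabs_Im_le (z : C) : Rabs (Im z) <= Cmod z.
Proof. eapply Rle_trans; [apply Rmax_r|apply Rmax_Cmod]. Qed.

(** Compactness is applied to the square that contains the disk.  Around
    centres outside the unit disk the radius is taken so small that no point of
    the disk of radius [rho] is concerned. *)
Lemma uniformly_expands_disk (f : C -> C) (rho : R) :
  analytic_on_disk f -> rho < 1 ->
  exists d, 0 < d /\ forall z, Cmod z <= rho -> uniformly_expands f d z.
Proof.
intros Hf Hrho.
assert (Hloc : forall c : C, exists d : posreal, forall z, Cmod (z - c) < 2 * d ->
  Cmod z <= rho -> uniformly_expands f d z).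
{ intros c. destruct (Rlt_le_dec (Cmod c) 1) as [Hc|Hc].
  - destruct (uniformly_expands_near f c (Hf c Hc)) as [d [Hd H]].
    exists (mkposreal d Hd). intros z Hz _. exact (H z Hz).
  - assert (Hd : 0 < (1 - rho) / 2) by lra.
    exists (mkposreal _ Hd). simpl. intros z Hz Hz1. exfalso.
    assert (H := Cmod_triangle z (c - z)).
    replace (z + (c - z))%C with c in H by cring.
    rewrite Cmod_minus_sym in H. lra. }
pose (delta := fun u v : R => proj1_sig (constructive_indefinite_description _ (Hloc (u, v)))).
assert (Hdelta : forall u v z, Cmod (z - (u, v)) < 2 * delta u v ->
  Cmod z <= rho -> uniformly_expands f (delta u v) z).
{ intros u v. unfold delta. apply proj2_sig. }
destruct (compactness_value_2d (-1) 1 (-1) 1 delta) as [d Hd].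
exists d. split; [apply cond_pos|]. intros z Hz.
assert (HRe := Rabs_Re_le z). assert (HIm := Rabs_Im_le z).
destruct (NNPP _ (Hd (Re z) (Im z) ltac:(apply Rabs_le_between; lra)
  ltac:(apply Rabs_le_between; lra))) as [u [v [_ [_ [Hu [Hv Hle]]]]]].
apply uniformly_expands_le with (delta u v); [split; [apply cond_pos|exact Hle]|].
apply Hdelta; [|exact Hz].
eapply Rle_lt_trans; [apply Cmod_le_Re_Im|].
destruct z as [x y]. simpl in *.
change (Rabs (x - u) + Rabs (y - v) < 2 * delta u v). lra.
Qed.

Lemma cseries_drop (u : nat -> C) (n : nat) (l : C) :
  (forall k, (k < n)%nat -> u k = RtoC 0) -> cseries u l ->
  cseries (fun j => u (n + j)%nat) l.
Proof.
revert u. induction n as [|n IH]; intros u Hz Hu; [exact Hu|].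
apply (IH (fun k => u (S k))).
- intros k Hk. apply Hz. lia.
- apply cseries_shift. rewrite Hz by lia. replace (RtoC 0 + l)%C with l by cring. exact Hu.
Qed.

Lemma expands_unique (f : C -> C) (z0 : C) (a b : nat -> C) (d d' : R) :
  0 < d -> 0 < d' -> expands f z0 a d -> expands f z0 b d' -> forall n, a n = b n.
Proof.
intros Hd Hd' Ha Hb.
apply (psum_coef_unique a b (Rmin d d')); [now apply Rmin_pos|].
intros h Hh. exists (f (z0 + h)%C).
assert (H1 := Rmin_l d d'). assert (H2 := Rmin_r d d').
split; [apply Ha|apply Hb]; lra.
Qed.

(** One continuation step: [f] is the sum of [a] on the disk of radius [rho] and
    has expansions with the uniform constant [d] there. *)
Section Continuation.

Variables (f : C -> C) (a : nat -> C) (rho d : R).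
Hypothesis Hrho : 0 < rho.
Hypothesis Hd : 0 < d.
Hypothesis Hf : forall z, Cmod z < rho -> uniformly_expands f d z.
Hypothesis Ha : forall z, Cmod z < rho -> psum a z (f z).

Let expands0 : expands f (RtoC 0) a rho.
Proof. intros h Hh. rewrite Cplus_0_l. now apply Ha. Qed.

(** The recentred series and the uniform local expansion agree near [z0], hence
    have equal coefficients: the former inherits the bounds of the latter. *)
Lemma taylor_coef_bound (z0 : C) :
  Cmod z0 < rho ->
  exists b, (forall n, cseries (recentred_term a z0 n) (b n)) /\
    expands f z0 b d /\ majorized b (/ d) d.
Proof.
intros Hz0. assert (H0 := Cmod_ge_0 z0).
set (r := (Cmod z0 + rho) / 2).
destruct (expands_majorized f _ a rho r expands0 ltac:(unfold r; lra)) as [M [_ HM]].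
destruct (expands_recentre f a _ rho M r z0 expands0 HM) as [b [Hb [Hexp _]]];
  [unfold r; lra|unfold r; lra|].
rewrite Cplus_0_l in Hexp.
destruct (Hf z0 Hz0) as [b' [Hb1 Hb2]].
assert (E : forall n, b n = b' n).
{ apply (expands_unique f z0 b b' (r - Cmod z0) d); auto. unfold r; lra. }
exists b'. split; [|split; assumption].
intros n. rewrite <- E. apply Hb.
Qed.

(** The [n]-th Taylor coefficient at [z] is itself a power series in [z], with
    coefficients [binom (n + j) n a_{n+j}]; it is bounded by [1 / d^(n+1)] on the
    whole disk, so Cauchy's estimate applies to it. *)
Lemma binomial_coef_bound (r : R) (n j : nat) :
  0 <= r < rho ->
  Cmod (a (n + j)%nat) * INR (binom (n + j) n) * r ^ j * d ^ n <= / d.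
Proof.
intros Hr.
set (alpha := fun j => (a (n + j)%nat * RtoC (INR (binom (n + j) n)))%C).
assert (Halpha : forall z, Cmod z < rho -> exists s, psum alpha z s /\ Cmod s <= / d / d ^ n).
{ intros z Hz. destruct (taylor_coef_bound z Hz) as [b [Hb [_ HM]]].
  exists (b n). split.
  - apply cseries_ext with (fun j => recentred_term a z n (n + j)%nat).
    + intros k. unfold recentred_term, alpha.
      replace (n + k - n)%nat with k by lia. cring.
    + apply cseries_drop; [|apply Hb].
      intros k Hk. unfold recentred_term. rewrite binom_lt by exact Hk. simpl. cring.
  - assert (Hp : 0 < d ^ n) by now apply pow_lt.
    apply (Rmult_le_reg_r (d ^ n)); [exact Hp|].
    replace (/ d / d ^ n * d ^ n) with (/ d) by (field; lra). apply HM. }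
set (r' := (r + rho) / 2).
assert (Er : Cmod (RtoC r') = r') by (rewrite Cmod_R; apply Rabs_pos_eq; unfold r'; lra).
destruct (Halpha (RtoC r')) as [s [Hs _]]; [rewrite Er; unfold r'; lra|].
destruct (psum_majorized _ _ _ Hs) as [M [_ HM]]. rewrite Er in HM.
assert (Hc : majorized alpha (/ d / d ^ n) r).
{ apply (psum_cauchy alpha M r'); [exact HM|unfold r'; lra|].
  intros z Hz. apply Halpha. lra. }
specialize (Hc j). unfold alpha in Hc.
rewrite Cmod_mult, Cmod_R, Rabs_pos_eq in Hc by apply pos_INR.
assert (Hp : 0 < d ^ n) by now apply pow_lt.
apply Rle_trans with (/ d / d ^ n * d ^ n).
- apply Rmult_le_compat_r; lra.
- right. field. lra.
Qed.

(** With [N = n + j] fixed, the [n]-th term of the binomial expansion of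
    [(r + d / 2)^N], multiplied by [|a_N|], is at most [(1 / d) (1 / 2)^n]. *)
Lemma majorized_beyond (r : R) : 0 <= r < rho -> majorized a (2 / d) (r + d / 2).
Proof.
intros Hr N. rewrite <- rbinomial_theorem, <- rsum_mult_l.
apply Rle_trans with (sum_n (fun n => / d * (1 / 2) ^ n) N).
- apply rsum_le. intros n Hn. unfold rbinomial_term.
  assert (H := binomial_coef_bound r n (N - n) Hr).
  replace (n + (N - n))%nat with N in H by lia.
  replace (d / 2) with (d * (1 / 2)) by field. rewrite Rpow_mult_distr.
  assert (Hp : 0 <= (1 / 2) ^ n) by (apply pow_le; lra).
  apply (Rmult_le_compat_r _ _ _ Hp) in H. lra.
- replace (2 / d) with (/ d / (1 - 1 / 2)) by (field; lra).
  apply is_series_partial_le; [|apply geom_series; lra].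
  intros k. apply Rmult_le_pos; [left; now apply Rinv_0_lt_compat|apply pow_le; lra].
Qed.

(** A point beyond [rho] is reached from a point [z0] of the old disk on the same
    radius; there both [f] and the sum of [a] are given by the Taylor series at
    [z0]. *)
Lemma psum_beyond (z : C) : Cmod z < rho + d / 2 -> psum a z (f z).
Proof.
intros Hz. assert (H0 := Cmod_ge_0 z).
set (r := Rmax (rho / 2) ((Cmod z - d / 2 + rho) / 2)).
assert (Hr1 : rho / 2 <= r) by apply Rmax_l.
assert (Hr2 : (Cmod z - d / 2 + rho) / 2 <= r) by apply Rmax_r.
assert (Hr3 : r < rho) by (apply Rmax_lub_lt; lra).
assert (Hr4 : Cmod z < r + d / 2) by lra.
assert (HM := majorized_beyond r ltac:(lra)).
set (t := r / (r + d / 2)).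
assert (Ht : 0 <= t < 1) by (apply ratio_bounds; lra).
assert (Ht1 : t * (r + d / 2) = r) by (unfold t; field; lra).
set (z0 := (RtoC t * z)%C). set (h := (RtoC (1 - t) * z)%C).
assert (Ez0 : Cmod z0 = t * Cmod z) by (unfold z0; rewrite Cmod_mult, Cmod_R, Rabs_pos_eq; lra).
assert (Eh : Cmod h = (1 - t) * Cmod z) by (unfold h; rewrite Cmod_mult, Cmod_R, Rabs_pos_eq; lra).
assert (Ez : (z0 + h)%C = z) by (unfold z0, h; rewrite RtoC_minus; cring).
assert (Hz0 : Cmod z0 < rho) by (rewrite Ez0; nra).
assert (Hh : Cmod h < d) by (rewrite Eh; nra).
destruct (recentre a (2 / d) (r + d / 2) z0 HM ltac:(rewrite Ez0; nra)) as [b [Hb [_ Hsum]]].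
destruct (taylor_coef_bound z0 Hz0) as [b' [Hb' [Hexp _]]].
destruct (psum_ex a _ _ z HM Hr4) as [s Hs].
assert (H1 : psum b h s) by (apply Hsum; rewrite ?Ez; [lra|exact Hs]).
assert (H2 : psum b h (f z)).
{ rewrite <- Ez. apply cseries_ext with (2 := Hexp h Hh).
  intros n. f_equal. now apply cseries_unique with (1 := Hb' n). }
now rewrite <- (psum_unique _ _ _ _ H1 H2).
Qed.

End Continuation.

(** The gain [d / 2] of a continuation step depends only on the closed disk of
    radius [rho0 < 1], so finitely many steps fill that disk. *)
Lemma analytic_on_disk_psum (f : C -> C) :
  analytic_on_disk f -> exists a, forall z, Cmod z < 1 -> psum a z (f z).
Proof.
intros Hf.
assert (H0 : analytic_at f (RtoC 0)) by (apply Hf; unfold unit_disk; rewrite Cmod_0; lra).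
apply analytic_at_expands in H0. destruct H0 as [a [r0 [Hr0 Ha]]].
exists a. intros z Hz. assert (Hz0 := Cmod_ge_0 z).
set (rho0 := (1 + Cmod z) / 2).
destruct (uniformly_expands_disk f rho0 Hf) as [d [Hd Hexp]]; [unfold rho0; lra|].
assert (Hind : forall k w, Cmod w < Rmin rho0 (r0 + INR k * (d / 2)) -> psum a w (f w)).
{ induction k as [|k IH]; intros w Hw.
  - rewrite <- (Cplus_0_l w) at 2. apply Ha.
    assert (H1 := Rmin_r rho0 (r0 + INR 0 * (d / 2))). simpl in H1, Hw. lra.
  - rewrite S_INR in Hw.
    assert (Hk : 0 <= INR k * (d / 2)) by (apply Rmult_le_pos; [apply pos_INR|lra]).
    apply (psum_beyond f a (Rmin rho0 (r0 + INR k * (d / 2))) d).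
    + apply Rmin_pos; [unfold rho0|]; lra.
    + exact Hd.
    + intros u Hu. apply Hexp.
      assert (H1 := Rmin_l rho0 (r0 + INR k * (d / 2))). lra.
    + exact IH.
    + destruct (Rmin_case_strong rho0 (r0 + INR k * (d / 2))
        (fun m => Rmin rho0 (r0 + (INR k + 1) * (d / 2)) <= m + d / 2)).
      * intros _. assert (H1 := Rmin_l rho0 (r0 + (INR k + 1) * (d / 2))). lra.
      * intros _. assert (H1 := Rmin_r rho0 (r0 + (INR k + 1) * (d / 2))). lra.
      * lra.
      * lra. }
destruct (INR_unbounded (2 * rho0 / d)) as [k Hk].
apply (Hind k). apply Rmin_glb_lt; [unfold rho0; lra|].
assert (H1 : rho0 < INR k * (d / 2)).
{ apply (Rmult_lt_compat_r (d / 2)) in Hk; [|lra].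
  replace (2 * rho0 / d * (d / 2)) with rho0 in Hk by (field; lra). lra. }
unfold rho0 in *. lra.
Qed.

(** * Differentiation of power series *)

Definition disk_sum (a : nat -> C) (f : C -> C) : Prop :=
  forall z, Cmod z < 1 -> psum a z (f z).

Lemma disk_sum_expands (a : nat -> C) (f : C -> C) :
  disk_sum a f -> expands f (RtoC 0) a 1.
Proof. intros H h Hh. rewrite Cplus_0_l. now apply H. Qed.

Lemma disk_sum_majorized (a : nat -> C) (f : C -> C) (r : R) :
  disk_sum a f -> 0 <= r < 1 -> exists M, 0 < M /\ majorized a M r.
Proof.
intros H Hr. exact (expands_majorized f _ a 1 r (disk_sum_expands a f H) Hr).
Qed.

Lemma disk_sum_recentre (a : nat -> C) (f : C -> C) (z : C) :
  disk_sum a f -> Cmod z < 1 ->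
  exists b d, 0 < d /\ expands f z b d /\
    forall n, cseries (recentred_term a z n) (b n).
Proof.
intros H Hz. assert (Hz0 := Cmod_ge_0 z). set (r := (Cmod z + 1) / 2).
destruct (disk_sum_majorized a f r H ltac:(unfold r; lra)) as [M [_ HM]].
destruct (expands_recentre f a _ 1 M r z (disk_sum_expands a f H) HM) as [b [Hb [Hexp _]]];
  [unfold r; lra|unfold r; lra|].
rewrite Cplus_0_l in Hexp. exists b, (r - Cmod z).
split; [unfold r; lra|split; assumption].
Qed.

Lemma disk_sum_analytic (a : nat -> C) (f : C -> C) : disk_sum a f -> analytic_on_disk f.
Proof.
intros H z Hz. apply analytic_at_expands.
destruct (disk_sum_recentre a f z H Hz) as [b [d [Hd [Hexp _]]]]. now exists b, d.
Qed.

(** Differentiability in the strong form available for power series.  It gives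
    both the complex derivative and the real derivatives along radii. *)
Definition quadratic_approx (f : C -> C) (z l : C) : Prop :=
  exists K d, 0 < K /\ 0 < d /\ forall h, Cmod h < d ->
    Cmod (f (z + h) - f z - l * h)%C <= K * Cmod h ^ 2.

Lemma expands_quadratic (f : C -> C) (z : C) (b : nat -> C) (d : R) :
  0 < d -> expands f z b d -> quadratic_approx f z (b 1%nat).
Proof.
intros Hd Hf.
assert (E0 : f z = b 0%nat).
{ apply (psum_unique b (RtoC 0)); [|apply psum_0].
  rewrite <- (Cplus_0_r z) at 1. apply Hf. now rewrite Cmod_0. }
set (r := d / 2). assert (Hr : 0 < r) by (unfold r; lra).
destruct (expands_majorized f z b d r Hf ltac:(unfold r; lra)) as [M [HM0 HM]].
exists (2 * M / r ^ 2), (r / 2).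
assert (Hr2 : 0 < r ^ 2) by now apply pow_lt.
split; [apply Rdiv_lt_0_compat; lra|split; [lra|]]. intros h Hh.
assert (Hh0 := Cmod_ge_0 h).
assert (Hterm : forall n, Cmod (b n * h ^ n) <= M * (Cmod h / r) ^ n).
{ intros n. rewrite Cmod_term. apply majorized_geom; [exact HM|lra]. }
assert (Hq : 0 <= Cmod h / r < 1 / 2).
{ split; [apply Rdiv_le_0_compat; lra|].
  apply (Rmult_lt_reg_r r); [exact Hr|]. field_simplify; lra. }
set (q := Cmod h / r) in *.
assert (Hs : psum b h (f (z + h)%C)) by (apply Hf; unfold r in Hh; lra).
assert (Hrem := cseries_remainder _ _ _ _ 1 Hs (geom_series M q ltac:(lra)) Hterm).
rewrite csum_S, csum_0, rsum_S, rsum_0 in Hrem.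
replace (f (z + h)%C - f z - b 1%nat * h)%C
  with (f (z + h)%C - (b 0%nat * h ^ 0 + b 1%nat * h ^ 1))%C
  by (rewrite E0; simpl; cring).
eapply Rle_trans; [exact Hrem|].
replace (Cmod h) with (q * r) by (unfold q; field; lra).
replace (2 * M / r ^ 2 * (q * r) ^ 2) with (2 * M * q ^ 2) by (field; lra).
replace (M / (1 - q) - (M * q ^ 0 + M * q ^ 1)) with (M * q ^ 2 / (1 - q)) by (field; lra).
apply (Rmult_le_reg_r (1 - q)); [lra|].
replace (M * q ^ 2 / (1 - q) * (1 - q)) with (M * q ^ 2) by (field; lra).
assert (0 <= M * q ^ 2) by (apply Rmult_le_pos; [lra|apply pow2_ge_0]). nra.
Qed.

Lemma quadratic_approx_C_derive (f : C -> C) (z l : C) :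
  quadratic_approx f z l -> C_derive f z = l.
Proof.
intros [K [d [HK [Hd H]]]]. apply is_C_derive_unique.
split; [apply is_linear_scal_l|].
intros x Hx. apply (is_filter_lim_locally_unique (V := AbsRing_NormedModule C_AbsRing)) in Hx.
subst x. intros eps.
assert (Hm : 0 < Rmin d (eps / K)).
{ apply Rmin_pos; [exact Hd|]. apply Rdiv_lt_0_compat; [apply cond_pos|exact HK]. }
assert (Hnear : forall y : C, Cmod (y - z) < Rmin d (eps / K) ->
  Cmod (f y - f z - (y - z) * l)%C <= eps * Cmod (y - z)); [|exists (mkposreal _ Hm); exact Hnear].
intros y Hy.
assert (H1 := Rmin_l d (eps / K)). assert (H2 := Rmin_r d (eps / K)).
specialize (H (y - z)%C ltac:(lra)).
replace (z + (y - z))%C with y in H by cring.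
rewrite (Cmult_comm (y - z) l). eapply Rle_trans; [exact H|].
assert (H3 : K * Cmod (y - z) <= eps).
{ apply Rle_trans with (K * (eps / K)); [apply Rmult_le_compat_l; lra|].
  right. field. lra. }
assert (H4 := Cmod_ge_0 (y - z)). nra.
Qed.

(** Applied with [L] the real and the imaginary part. *)
Lemma quadratic_approx_ray (f : C -> C) (L : C -> R) (z l : C) (t : R) :
  (forall x y, L (x - y)%C = L x - L y) ->
  (forall x, Rabs (L x) <= Cmod x) ->
  (forall c x, L (RtoC c * x)%C = c * L x) ->
  quadratic_approx f (RtoC t * z) l ->
  is_derive (fun s => L (f (RtoC s * z)%C)) t (L (l * z)%C).
Proof.
intros Lminus Lbound Lscal [K [d [HK [Hd H]]]].
apply is_derive_Reals. intros eps Heps.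
set (c := Cmod z). assert (Hc : 0 <= c) by apply Cmod_ge_0.
assert (Hm : 0 < Rmin (d / (c + 1)) (eps / (K * c ^ 2 + 1))).
{ assert (0 <= K * c ^ 2) by (apply Rmult_le_pos; [lra|apply pow2_ge_0]).
  apply Rmin_pos; apply Rdiv_lt_0_compat; lra. }
exists (mkposreal _ Hm). intros s Hs0 Hs.
change (Rabs s < Rmin (d / (c + 1)) (eps / (K * c ^ 2 + 1))) in Hs.
assert (H1 := Rlt_le_trans _ _ _ Hs (Rmin_l _ _)).
assert (H2 := Rlt_le_trans _ _ _ Hs (Rmin_r _ _)).
assert (Hsp : 0 < Rabs s) by now apply Rabs_pos_lt.
assert (Ecs : Cmod (RtoC s * z) = Rabs s * c) by now rewrite Cmod_mult, Cmod_R.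
assert (Hq : Cmod (f (RtoC t * z + RtoC s * z) - f (RtoC t * z) - l * (RtoC s * z))%C
  <= K * (Rabs s * c) ^ 2).
{ rewrite <- Ecs. apply H. rewrite Ecs.
  apply (Rmult_lt_compat_r (c + 1)) in H1; [|lra].
  replace (d / (c + 1) * (c + 1)) with d in H1 by (field; lra). nra. }
replace (RtoC t * z + RtoC s * z)%C with (RtoC (t + s) * z)%C in Hq
  by (rewrite RtoC_plus; cring).
replace (l * (RtoC s * z))%C with (RtoC s * (l * z))%C in Hq by cring.
assert (HL := Rle_trans _ _ _ (Lbound _) Hq). rewrite !Lminus, Lscal in HL.
set (D := L (f (RtoC (t + s) * z)%C) - L (f (RtoC t * z)%C)) in *.
replace (D / s - L (l * z)%C) with ((D - s * L (l * z)%C) * / s) by (field; exact Hs0).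
rewrite Rabs_mult, Rabs_inv.
apply (Rmult_lt_reg_r (Rabs s)); [exact Hsp|].
rewrite Rmult_assoc, Rinv_l, Rmult_1_r by lra.
eapply Rle_lt_trans; [exact HL|].
assert (0 <= K * c ^ 2) by (apply Rmult_le_pos; [lra|apply pow2_ge_0]).
apply (Rmult_lt_compat_r (K * c ^ 2 + 1)) in H2; [|lra].
replace (eps / (K * c ^ 2 + 1) * (K * c ^ 2 + 1)) with eps in H2 by (field; lra).
replace (K * (Rabs s * c) ^ 2) with (Rabs s * (K * c ^ 2) * Rabs s) by ring.
apply Rmult_lt_compat_r; [exact Hsp|]. nra.
Qed.

Definition deriv_coef (a : nat -> C) (n : nat) : C := (RtoC (INR (S n)) * a (S n))%C.

Lemma disk_sum_quadratic (a : nat -> C) (f : C -> C) (z : C) :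
  disk_sum a f -> Cmod z < 1 ->
  exists l, psum (deriv_coef a) z l /\ quadratic_approx f z l.
Proof.
intros H Hz. destruct (disk_sum_recentre a f z H Hz) as [b [d [Hd [Hexp Hb]]]].
exists (b 1%nat). split; [|now apply expands_quadratic with d].
apply cseries_ext with (fun j => recentred_term a z 1 (1 + j)).
- intros n. unfold recentred_term, deriv_coef. rewrite binom_1.
  replace (1 + n - 1)%nat with n by lia. change (1 + n)%nat with (S n). cring.
- apply cseries_drop; [|apply Hb].
  intros k Hk. unfold recentred_term. rewrite binom_lt by exact Hk. simpl. cring.
Qed.

Lemma disk_sum_derive (a : nat -> C) (f : C -> C) :
  disk_sum a f -> disk_sum (deriv_coef a) (C_derive f).
Proof.
intros H z Hz. destruct (disk_sum_quadratic a f z H Hz) as [l [Hl Hq]].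
now rewrite (quadratic_approx_C_derive f z l Hq).
Qed.

Definition shift_coef (a : nat -> C) (n : nat) : C :=
  match n with 0%nat => RtoC 0 | S m => a m end.

Lemma psum_shift (a : nat -> C) (z s : C) : psum a z s -> psum (shift_coef a) z (z * s)%C.
Proof.
intros H. unfold psum.
replace (z * s)%C with (shift_coef a 0 * z ^ 0 + z * s)%C by (simpl; cring).
apply (cseries_shift (fun n => (shift_coef a n * z ^ n)%C)).
apply cseries_ext with (2 := cseries_scal z _ _ H).
intros n. simpl shift_coef. rewrite Cpow_S. cring.
Qed.

Lemma psum_ext (a b : nat -> C) (z s : C) : (forall n, a n = b n) -> psum a z s -> psum b z s.
Proof. intros H. apply cseries_ext. intros n. now rewrite H. Qed.

Lemma psum_plus (a b : nat -> C) (z s t : C) :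
  psum a z s -> psum b z t -> psum (fun n => (a n + b n)%C) z (s + t)%C.
Proof.
intros Ha Hb. apply cseries_ext with (2 := cseries_plus _ _ _ _ Ha Hb). intros n. cring.
Qed.

Lemma psum_scal (c : C) (a : nat -> C) (z s : C) :
  psum a z s -> psum (fun n => (c * a n)%C) z (c * s)%C.
Proof. intros Ha. apply cseries_ext with (2 := cseries_scal c _ _ Ha). intros n. cring. Qed.

Lemma psum_without_constant (a : nat -> C) (z s : C) :
  psum a z s ->
  psum (fun n => match n with 0%nat => RtoC 0 | S _ => a n end) z (s - a 0%nat)%C.
Proof.
intros H. set (b := fun n => match n with 0%nat => RtoC 0 | S _ => a n end).
unfold psum. replace (s - a 0%nat)%C with (b 0%nat * z ^ 0 + (s - a 0%nat))%C by (simpl; cring).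
apply (cseries_shift (fun n => (b n * z ^ n)%C)).
apply (cseries_shift (fun n => (a n * z ^ n)%C)).
replace (a 0%nat * z ^ 0 + (s - a 0%nat))%C with s by (simpl; cring). exact H.
Qed.

(** * The differential operator on coefficients *)

(** The operators [z^k D^k] are diagonal on monomials: [z^n] is multiplied by
    [n (n - 1) ... (n - k + 1)]. *)
Lemma psum_z_derive (p : C -> C) (a : nat -> C) (z : C) : disk_sum a p -> Cmod z < 1 ->
  psum (fun n => (RtoC (INR n) * a n)%C) z (z * C_derive p z)%C.
Proof.
intros Hp Hz. apply psum_ext with (shift_coef (deriv_coef a)).
- intros [|n]; [simpl; cring|reflexivity].
- apply psum_shift. now apply disk_sum_derive.
Qed.

Lemma psum_z2_derive2 (p : C -> C) (a : nat -> C) (z : C) : disk_sum a p -> Cmod z < 1 ->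
  psum (fun n => (RtoC (INR n * (INR n - 1)) * a n)%C) z
    (z * z * C_derive (C_derive p) z)%C.
Proof.
intros Hp Hz. rewrite <- Cmult_assoc.
apply psum_ext with (shift_coef (fun n => (RtoC (INR n) * deriv_coef a n)%C)).
- intros [|n]; [simpl; rewrite Rmult_0_l; cring|].
  unfold shift_coef, deriv_coef. rewrite S_INR.
  replace (INR n + 1 - 1) with (INR n) by ring. rewrite RtoC_mult. cring.
- apply psum_shift. apply psum_z_derive; [now apply disk_sum_derive|exact Hz].
Qed.

Lemma psum_z3_derive3 (p : C -> C) (a : nat -> C) (z : C) : disk_sum a p -> Cmod z < 1 ->
  psum (fun n => (RtoC (INR n * (INR n - 1) * (INR n - 2)) * a n)%C) z
    (z * z * z * C_derive (C_derive (C_derive p)) z)%C.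
Proof.
intros Hp Hz.
replace (z * z * z * C_derive (C_derive (C_derive p)) z)%C
  with (z * (z * z * C_derive (C_derive (C_derive p)) z))%C by cring.
apply psum_ext with (shift_coef (fun n => (RtoC (INR n * (INR n - 1)) * deriv_coef a n)%C)).
- intros [|n]; [simpl; rewrite !Rmult_0_l; cring|].
  unfold shift_coef, deriv_coef. rewrite S_INR.
  replace (INR n + 1 - 1) with (INR n) by ring.
  replace (INR n + 1 - 2) with (INR n - 1) by ring. rewrite !RtoC_mult. cring.
- apply psum_shift. apply psum_z2_derive2; [now apply disk_sum_derive|exact Hz].
Qed.

Definition operator_multiplier (g1 g2 g3 : R) (n : nat) : R :=
  1 + g1 * INR n + g2 * (INR n * (INR n - 1)) + g3 * (INR n * (INR n - 1) * (INR n - 2)).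

Lemma operator_psum (g1 g2 g3 : R) (p : C -> C) (a : nat -> C) (z : C) :
  disk_sum a p -> Cmod z < 1 ->
  psum (fun n => (RtoC (operator_multiplier g1 g2 g3 n) * a n)%C) z
    (p z + RtoC g1 * z * C_derive p z
         + RtoC g2 * (z * z) * C_derive (C_derive p) z
         + RtoC g3 * (z * z * z) * C_derive (C_derive (C_derive p)) z)%C.
Proof.
intros Hp Hz.
assert (H0 := Hp z Hz).
assert (H1 := psum_scal (RtoC g1) _ _ _ (psum_z_derive p a z Hp Hz)).
assert (H2 := psum_scal (RtoC g2) _ _ _ (psum_z2_derive2 p a z Hp Hz)).
assert (H3 := psum_scal (RtoC g3) _ _ _ (psum_z3_derive3 p a z Hp Hz)).
assert (H := psum_plus _ _ _ _ _ (psum_plus _ _ _ _ _ (psum_plus _ _ _ _ _ H0 H1) H2) H3).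
rewrite <- !Cmult_assoc. rewrite <- !Cmult_assoc in H.
apply psum_ext with (2 := H).
intros n. unfold operator_multiplier. rewrite !RtoC_plus, !RtoC_mult. cring.
Qed.

(** For natural [n] the products [n (n - 1)] and [n (n - 1) (n - 2)] are not
    negative, although they are so for some real [n]. *)
Lemma operator_multiplier_ge (g1 g2 g3 : R) (n : nat) :
  0 <= g2 -> 0 <= g3 -> g1 * INR n <= operator_multiplier g1 g2 g3 n.
Proof.
intros H2 H3. unfold operator_multiplier.
assert (Ha : 0 <= INR n * (INR n - 1) /\ 0 <= INR n * (INR n - 1) * (INR n - 2)).
{ destruct n as [|[|n]]; [simpl; lra|simpl; lra|].
  rewrite !S_INR. assert (H := pos_INR n).
  split; [apply Rmult_le_pos; lra|].
  apply Rmult_le_pos; [apply Rmult_le_pos|]; lra. }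
destruct Ha as [Ha Hb].
assert (0 <= g2 * (INR n * (INR n - 1))) by now apply Rmult_le_pos.
assert (0 <= g3 * (INR n * (INR n - 1) * (INR n - 2))) by now apply Rmult_le_pos.
lra.
Qed.

Lemma sum_inv_squares (N : nat) : sum_n (fun n => / INR (S n) ^ 2) N <= 2.
Proof.
assert (H : sum_n (fun n => / INR (S n) ^ 2) N <= 2 - / INR (S N)).
{ induction N as [|N IH].
  - rewrite rsum_0. simpl. lra.
  - rewrite rsum_S. assert (HN := lt_0_INR (S N) ltac:(lia)).
    rewrite (S_INR (S N)). set (x := INR (S N)) in *.
    assert (/ (x + 1) ^ 2 <= / x - / (x + 1)); [|lra].
    replace (/ x - / (x + 1)) with (/ (x * (x + 1))) by (field; lra).
    apply Rinv_le_contravar; nra. }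
assert (H1 : 0 < / INR (S N)) by (apply Rinv_0_lt_compat, lt_0_INR; lia). lra.
Qed.

(** Each [|a_n| r^n] is at most a product of [|c_n| r^n] and [1 / (5 E n)], two
    square-summable sequences.  The inequality of arithmetic and geometric means
    bounds the sum of the products by [1 / 6 + 3 / 25 < 1 / 3], because
    [sum 1 / n^2 <= 2]. *)
Lemma l1_bound_of_multiplier (a c : nat -> C) (E r : R) (N : nat) :
  0 < E -> 0 <= r ->
  (forall n, 5 * E * INR (S n) * Cmod (a (S n)) <= Cmod (c (S n))) ->
  sum_n (fun n => (Cmod (c (S n)) * r ^ S n) ^ 2) N <= E ^ 2 ->
  sum_n (fun n => Cmod (a (S n)) * r ^ S n) N <= 1 / 3.
Proof.
intros HE Hr Hac HcE.
apply Rle_trans with (sum_n (fun n =>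
  / (6 * E ^ 2) * (Cmod (c (S n)) * r ^ S n) ^ 2 + 3 / 50 * / INR (S n) ^ 2) N).
- apply rsum_le. intros n _.
  assert (Hn := lt_0_INR (S n) ltac:(lia)). set (k := INR (S n)) in *.
  assert (Hp : 0 <= r ^ S n) by now apply pow_le.
  assert (H1 := Rmult_le_compat_r _ _ _ Hp (Hac n)). fold k in H1.
  set (al := Cmod (a (S n)) * r ^ S n).
  set (x := Cmod (c (S n)) * r ^ S n) in *.
  replace (5 * E * k * Cmod (a (S n)) * r ^ S n) with (5 * E * k * al) in H1
    by (unfold al; ring).
  assert (Hal : al <= x / (5 * E * k)).
  { apply (Rmult_le_reg_l (5 * E * k)); [repeat apply Rmult_lt_0_compat; lra|].
    replace (5 * E * k * (x / (5 * E * k))) with x by (field; lra). exact H1. }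
  eapply Rle_trans; [exact Hal|].
  assert (Hsq := pow2_ge_0 (x / E - 3 / 5 / k)).
  (* the weights of the two squares make their sums at most 1/6 and 3/25 *)
  replace (/ (6 * E ^ 2) * x ^ 2 + 3 / 50 * / k ^ 2)
    with (x / (5 * E * k) + / 6 * (x / E - 3 / 5 / k) ^ 2) by (field; lra).
  lra.
- rewrite rsum_plus, !rsum_mult_l.
  assert (H1 := sum_inv_squares N).
  assert (HE2 : 0 < E ^ 2) by now apply pow_lt.
  assert (H2 : / (6 * E ^ 2) * sum_n (fun n => (Cmod (c (S n)) * r ^ S n) ^ 2) N <= / 6).
  { apply Rle_trans with (/ (6 * E ^ 2) * E ^ 2).
    - apply Rmult_le_compat_l; [left; apply Rinv_0_lt_compat; lra|exact HcE].
    - right. field. lra. }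
  lra.
Qed.

(** * The logarithm of a power series close to one *)

Definition conv (u v : nat -> C) (n : nat) : C := csum (fun j => (u j * v (n - j)%nat)%C) n.

Lemma cseries_undrop (u : nat -> C) (n : nat) (l : C) :
  (forall k, (k < n)%nat -> u k = RtoC 0) ->
  cseries (fun j => u (n + j)%nat) l -> cseries u l.
Proof.
revert u. induction n as [|n IH]; intros u Hz Hu; [exact Hu|].
replace l with (u 0%nat + l)%C by (rewrite Hz by lia; cring).
apply cseries_shift. apply IH; [|exact Hu].
intros k Hk. apply Hz. lia.
Qed.

(** The terms [u_n z^n v_k z^k], arranged by [N = n + k], form a triangular
    double series whose columns sum to [u_n z^n t]. *)
Lemma psum_conv (u v : nat -> C) (Mu Mv rho : R) (z s t : C) :
  majorized u Mu rho -> majorized v Mv rho -> Cmod z < rho ->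
  psum u z s -> psum v z t -> psum (conv u v) z (s * t)%C.
Proof.
intros Hu Hv Hz Hs Ht. assert (Hz0 := Cmod_ge_0 z).
pose (w := fun N n => if (n <=? N)%nat
  then ((u n * z ^ n) * (v (N - n)%nat * z ^ (N - n)))%C else RtoC 0).
assert (Hw : forall N n, (n <= N)%nat ->
  w N n = ((u n * z ^ n) * (v (N - n)%nat * z ^ (N - n)))%C).
{ intros N n H. unfold w. now rewrite (proj2 (Nat.leb_le n N) H). }
assert (Hw0 : forall N n, (N < n)%nat -> w N n = RtoC 0).
{ intros N n H. unfold w. now rewrite (proj2 (Nat.leb_gt n N) H). }
assert (Hrow : forall N, csum (w N) N = (conv u v N * z ^ N)%C).
{ intros N. unfold conv. rewrite Cmult_comm, <- csum_mult_l. apply csum_ext.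
  intros n Hn. rewrite Hw by exact Hn.
  replace (z ^ N)%C with (z ^ n * z ^ (N - n))%C
    by (rewrite <- Cpow_add_r; f_equal; lia). cring. }
assert (Habs : ex_series (fun N => sum_n (fun n => Cmod (w N n)) N)).
{ destruct (majorized_summable u Mu rho (Cmod z) Hu ltac:(lra)) as [U HU].
  destruct (majorized_summable v Mv rho (Cmod z) Hv ltac:(lra)) as [V HV].
  assert (Hp : forall c : C, forall n, 0 <= Cmod c * Cmod z ^ n)
    by (intros; apply Rmult_le_pos; [apply Cmod_ge_0|now apply pow_le]).
  exists (U * V).
  eapply is_series_ext; [|apply (is_series_mult_pos _ _ _ _ HU HV)]; [|auto|auto].
  intros N. cbv beta. rewrite <- sum_n_Reals. apply rsum_ext. intros n Hn.
  now rewrite Hw, Cmod_mult, !Cmod_term by exact Hn. }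
destruct (cseries_abs_ex (fun N => csum (w N) N) _ (fun N => Cmod_csum (w N) N) Habs)
  as [l Hl].
assert (Hcol : forall n, cseries (fun N => w N n) (u n * z ^ n * t)%C).
{ intros n. apply cseries_undrop with n; [intros k Hk; now apply Hw0|].
  apply cseries_ext with (2 := cseries_scal (u n * z ^ n)%C _ _ Ht).
  intros k. rewrite Hw by lia. now replace (n + k - n)%nat with k by lia. }
assert (Hex := cseries_triangle_exchange w _ l Hw0 Habs Hl Hcol).
assert (E : l = (s * t)%C).
{ apply cseries_unique with (1 := Hex).
  rewrite (Cmult_comm s t). apply cseries_ext with (2 := cseries_scal t _ _ Hs).
  intros n. cring. }
rewrite <- E. apply cseries_ext with (2 := Hl). exact Hrow.
Qed.

(** The quotient of the power series [c] by [a], when [a 0 = 1], truncated to its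
    first [n] coefficients: solving [conv v a n = c n] for [v n] uses all earlier
    ones. *)
Fixpoint quotient_prefix (c a : nat -> C) (n : nat) : nat -> C :=
  match n with
  | 0%nat => fun _ => RtoC 0
  | S m => fun k =>
      if (k =? m)%nat
      then (c m - conv (quotient_prefix c a m) a m)%C
      else quotient_prefix c a m k
  end.

Lemma quotient_prefix_ge (c a : nat -> C) (n k : nat) :
  (n <= k)%nat -> quotient_prefix c a n k = RtoC 0.
Proof.
revert k. induction n as [|n IH]; intros k H; [reflexivity|]. simpl.
rewrite (proj2 (Nat.eqb_neq k n)) by lia. apply IH. lia.
Qed.

Lemma quotient_prefix_stable (c a : nat -> C) (n k : nat) :
  (k < n)%nat -> quotient_prefix c a n k = quotient_prefix c a (S k) k.
Proof.
intros H. induction H as [|n H IH]; [reflexivity|].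
rewrite <- IH. simpl. now rewrite (proj2 (Nat.eqb_neq k n)) by lia.
Qed.

Lemma conv_quotient (c a : nat -> C) :
  a 0%nat = RtoC 1 -> exists v, forall n, conv v a n = c n.
Proof.
intros Ha. exists (fun k => quotient_prefix c a (S k) k). intros n.
assert (Hlast : quotient_prefix c a (S n) n = (c n - conv (quotient_prefix c a n) a n)%C).
{ simpl. now rewrite Nat.eqb_refl. }
assert (H : conv (fun k => quotient_prefix c a (S k) k) a n =
  (conv (quotient_prefix c a n) a n + quotient_prefix c a (S n) n)%C).
{ unfold conv. destruct n as [|n].
  - rewrite !csum_0, Nat.sub_diag, Ha. simpl. cring.
  - rewrite !csum_S.
    rewrite (csum_ext (fun j => (quotient_prefix c a (S j) j * a (S n - j)%nat)%C)
      (fun j => (quotient_prefix c a (S n) j * a (S n - j)%nat)%C)).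
    + rewrite (quotient_prefix_ge c a (S n) (S n)) by lia.
      rewrite Nat.sub_diag, Ha. cring.
    + intros j Hj. now rewrite (quotient_prefix_stable c a (S n) j) by lia. }
rewrite H, Hlast. cring.
Qed.

Lemma rconv_sum_le (x y : nat -> R) (N : nat) (Y : R) :
  (forall n, 0 <= x n) -> (forall n, (n <= N)%nat -> sum_n y n <= Y) ->
  sum_n (fun n => sum_n (fun j => x j * y (n - j)%nat) n) N <= sum_n x N * Y.
Proof.
intros Hx HY.
assert (H : forall N, sum_n (fun n => sum_n (fun j => x j * y (n - j)%nat) n) N =
  sum_n (fun j => x j * sum_n y (N - j)) N).
{ clear. induction N as [|N IH]; [now rewrite !rsum_0|].
  rewrite rsum_S, IH, (rsum_S (fun j => x j * sum_n y (S N - j))).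
  rewrite (rsum_S (fun j => x j * y (S N - j)%nat)), <- Rplus_assoc, <- rsum_plus.
  f_equal.
  - apply rsum_ext. intros j Hj. replace (S N - j)%nat with (S (N - j)) by lia.
    rewrite rsum_S. lra.
  - rewrite Nat.sub_diag, rsum_0. reflexivity. }
rewrite H, Rmult_comm, <- rsum_mult_l. apply rsum_le. intros j Hj.
rewrite Rmult_comm. apply Rmult_le_compat_r; [apply Hx|]. apply HY. lia.
Qed.

(** The equation [w' a = a'] reads, at order [n],
    [(n+1) w_{n+1} = (n+1) a_{n+1} - sum_{j<n} (j+1) w_{j+1} a_{n-j}].  After
    division by [n + 1] the weights [(j+1) / (n+1)] are at most one, so
    [T = sum |w_n| r^n] satisfies [T <= 1/3 + T / 3]. *)
Lemma log_coef_bound (a w : nat -> C) (r : R) (N : nat) :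
  0 <= r -> a 0%nat = RtoC 1 ->
  (forall n, conv (deriv_coef w) a n = deriv_coef a n) ->
  (forall N, sum_n (fun n => Cmod (a (S n)) * r ^ S n) N <= 1 / 3) ->
  sum_n (fun n => Cmod (w (S n)) * r ^ S n) N <= 1 / 2.
Proof.
intros Hr Ha Hw HS.
set (x := fun n => Cmod (w (S n)) * r ^ S n).
set (y := fun n => match n with 0%nat => 0 | S m => Cmod (a (S m)) * r ^ S m end).
assert (Hx : forall n, 0 <= x n)
  by (intros; apply Rmult_le_pos; [apply Cmod_ge_0|now apply pow_le]).
assert (HY : forall n, sum_n y n <= 1 / 3).
{ intros [|n]; [rewrite rsum_0; simpl; lra|].
  assert (E : sum_n y (S n) = y 0%nat + sum_n (fun k => y (S k)) n).
  { induction n as [|n IH]; [now rewrite rsum_S, !rsum_0|].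
    rewrite rsum_S, IH, (rsum_S (fun k => y (S k))). lra. }
  rewrite E. specialize (HS n). simpl (y 0%nat). unfold y. lra. }
assert (Hstep : forall n, x n <= Cmod (a (S n)) * r ^ S n + sum_n (fun j => x j * y (n - j)%nat) n).
{ intros n. set (k := INR (S n)). assert (Hk : 0 < k) by (apply lt_0_INR; lia).
  assert (Hw1 : deriv_coef w n = (deriv_coef a n -
    match n with 0%nat => RtoC 0 | S m =>
      csum (fun j => deriv_coef w j * a (n - j)%nat)%C m end)%C).
  { rewrite <- Hw. unfold conv. destruct n as [|n].
    - rewrite csum_0, Nat.sub_diag, Ha. cring.
    - rewrite csum_S, Nat.sub_diag, Ha. cring. }
  assert (Hsum : Cmod (match n with 0%nat => RtoC 0 | S m =>
      csum (fun j => deriv_coef w j * a (n - j)%nat)%C m end) * r ^ S n <=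
      k * sum_n (fun j => x j * y (n - j)%nat) n).
  { destruct n as [|n].
    - rewrite Cmod_0, rsum_0. simpl. lra.
    - rewrite rsum_S, Nat.sub_diag. change (y 0%nat) with 0. rewrite Rmult_0_r, Rplus_0_r.
      rewrite <- rsum_mult_l.
      assert (Hp : 0 <= r ^ S (S n)) by now apply pow_le.
      eapply Rle_trans; [apply Rmult_le_compat_r; [exact Hp|apply Cmod_csum]|].
      rewrite Rmult_comm, <- rsum_mult_l. apply rsum_le. intros j Hj.
      rewrite Cmod_mult. unfold deriv_coef.
      rewrite Cmod_mult, Cmod_R, Rabs_pos_eq by apply pos_INR.
      replace (S n - j)%nat with (S (n - j)) by lia. unfold x, y.
      replace (r ^ S (S n)) with (r ^ S j * r ^ S (n - j))
        by (rewrite <- pow_add; f_equal; lia).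
      assert (Hjk : INR (S j) <= k) by (apply le_INR; lia).
      assert (Hq : 0 <= Cmod (w (S j)) * r ^ S j * (Cmod (a (S (n - j))) * r ^ S (n - j))).
      { apply Rmult_le_pos; (apply Rmult_le_pos; [apply Cmod_ge_0|now apply pow_le]). }
      apply (Rmult_le_compat_r _ _ _ Hq) in Hjk. lra. }
  apply (Rmult_le_reg_l k); [exact Hk|].
  assert (Hk1 : k * x n = Cmod (deriv_coef w n) * r ^ S n).
  { unfold deriv_coef, x. rewrite Cmod_mult, Cmod_R, Rabs_pos_eq by apply pos_INR.
    fold k. ring. }
  assert (Hk2 : k * (Cmod (a (S n)) * r ^ S n) = Cmod (deriv_coef a n) * r ^ S n).
  { unfold deriv_coef. rewrite Cmod_mult, Cmod_R, Rabs_pos_eq by apply pos_INR.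
    fold k. ring. }
  rewrite Rmult_plus_distr_l, Hk1, Hk2, Hw1.
  set (D := match n with 0%nat => _ | S m => _ end) in *.
  assert (Hp : 0 <= r ^ S n) by now apply pow_le.
  assert (Ht := Cmod_triangle (deriv_coef a n) (- D)). rewrite Cmod_opp in Ht.
  apply (Rmult_le_compat_r _ _ _ Hp) in Ht.
  unfold Cminus. lra. }
assert (H1 : sum_n x N <= 1 / 3 + sum_n x N * (1 / 3)).
{ eapply Rle_trans; [apply rsum_le; intros n _; apply Hstep|].
  rewrite rsum_plus. apply Rplus_le_compat; [apply HS|].
  apply rconv_sum_le; auto. }
change (sum_n x N <= 1 / 2). lra.
Qed.

Lemma cseries_bound_partial (u : nat -> C) (l : C) (B : R) :
  cseries u l -> (forall n, sum_n (fun k => Cmod (u k)) n <= B) -> Cmod l <= B.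
Proof.
intros Hu HB. apply le_epsilon. intros eps Heps.
destruct (proj1 (cseries_eps u l) Hu eps Heps) as [N HN].
specialize (HN N (le_n N)). specialize (HB N).
assert (H1 := Cmod_csum u N). assert (H2 := Cmod_triangle (csum u N) (l - csum u N)).
replace (csum u N + (l - csum u N))%C with l in H2 by cring.
rewrite (Cmod_minus_sym l) in H2. lra.
Qed.

(** For [|z| >= 1 / 2] the bound [1 / 2] suffices; for smaller [z] the missing
    constant term gives the factor [|z| / r] with [r = 1 / 2].  Both cases are
    covered by [r = max (|z|, 1 / 2)]. *)
Lemma schwarz_bound (w : nat -> C) (z s : C) :
  w 0%nat = RtoC 0 ->
  (forall r N, 0 <= r < 1 -> sum_n (fun n => Cmod (w (S n)) * r ^ S n) N <= 1 / 2) ->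
  Cmod z < 1 -> psum w z s -> Cmod s <= Cmod z.
Proof.
intros Hw0 Hw Hz Hs. assert (Hz0 := Cmod_ge_0 z).
set (r := Rmax (Cmod z) (1 / 2)).
assert (Hr1 : Cmod z <= r) by apply Rmax_l. assert (Hr2 : 1 / 2 <= r) by apply Rmax_r.
assert (Hr3 : r < 1) by (apply Rmax_lub_lt; lra).
assert (Hs' : cseries (fun n => (w (S n) * z ^ S n)%C) s).
{ apply (cseries_shift (fun n => (w n * z ^ n)%C)). rewrite Hw0.
  replace (RtoC 0 * z ^ 0 + s)%C with s by cring. exact Hs. }
apply (cseries_bound_partial _ _ _ Hs'). intros n.
apply Rle_trans with (sum_n (fun k => Cmod z / r * (Cmod (w (S k)) * r ^ S k)) n).
- apply rsum_le. intros k _. rewrite Cmod_term.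
  replace (Cmod z / r * (Cmod (w (S k)) * r ^ S k)) with (Cmod (w (S k)) * (Cmod z * r ^ k))
    by (simpl; field; lra).
  apply Rmult_le_compat_l; [apply Cmod_ge_0|]. simpl.
  apply Rmult_le_compat_l; [exact Hz0|]. apply pow_incr. lra.
- rewrite rsum_mult_l.
  apply Rle_trans with (Cmod z / r * (1 / 2)).
  + apply Rmult_le_compat_l; [apply Rdiv_le_0_compat; lra|]. apply Hw. lra.
  + apply (Rmult_le_reg_r r); [lra|].
    replace (Cmod z / r * (1 / 2) * r) with (Cmod z * (1 / 2)) by (field; lra). nra.
Qed.

Lemma Re_minus (x y : C) : Re (x - y)%C = Re x - Re y.
Proof. reflexivity. Qed.
Lemma Im_minus (x y : C) : Im (x - y)%C = Im x - Im y.
Proof. reflexivity. Qed.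
Lemma Re_scal (c : R) (x : C) : Re (RtoC c * x)%C = c * Re x.
Proof. unfold Re; simpl. ring. Qed.
Lemma Im_scal (c : R) (x : C) : Im (RtoC c * x)%C = c * Im x.
Proof. unfold Im; simpl. ring. Qed.

(** The two functions are the real and imaginary parts of
    [(A + i B) exp (- (al + i be))], and the hypotheses say that
    [(A + i B)' = (al + i be)' (A + i B)]. *)
Lemma exp_twist_derive (A B al be : R -> R) (t dA dB dal dbe : R) :
  is_derive A t dA -> is_derive B t dB -> is_derive al t dal -> is_derive be t dbe ->
  dA = dal * A t - dbe * B t -> dB = dal * B t + dbe * A t ->
  is_derive (fun s => exp (- al s) * (A s * cos (be s) + B s * sin (be s))) t 0 /\
  is_derive (fun s => exp (- al s) * (B s * cos (be s) - A s * sin (be s))) t 0.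
Proof.
intros HA HB Hal Hbe EA EB.
assert (XA : ex_derive A t) by now exists dA.
assert (XB : ex_derive B t) by now exists dB.
assert (Xal : ex_derive al t) by now exists dal.
assert (Xbe : ex_derive be t) by now exists dbe.
split; auto_derive; repeat split; auto;
  change (fun x => A x) with A; change (fun x => B x) with B;
  change (fun x => al x) with al; change (fun x => be x) with be;
  rewrite (is_derive_unique _ _ _ HA), (is_derive_unique _ _ _ HB),
    (is_derive_unique _ _ _ Hal), (is_derive_unique _ _ _ Hbe), EA, EB; ring.
Qed.

(** On the radius of [z] the function [f exp (- g)] has zero derivative, and it is
    equal to one at the origin. *)
Lemma Cexp_of_log_derivative (f g : C -> C) (z : C) :
  Cmod z < 1 -> f (RtoC 0) = RtoC 1 -> g (RtoC 0) = RtoC 0 ->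
  (forall u, Cmod u < 1 -> exists l, quadratic_approx g u l /\ quadratic_approx f u (l * f u)%C) ->
  f z = Cexp (g z).
Proof.
intros Hz Hf0 Hg0 H. assert (Hz0 := Cmod_ge_0 z).
set (A := fun s => Re (f (RtoC s * z)%C)). set (B := fun s => Im (f (RtoC s * z)%C)).
set (al := fun s => Re (g (RtoC s * z)%C)). set (be := fun s => Im (g (RtoC s * z)%C)).
assert (Hder : forall t, 0 <= t <= 1 ->
  is_derive (fun s => exp (- al s) * (A s * cos (be s) + B s * sin (be s))) t 0 /\
  is_derive (fun s => exp (- al s) * (B s * cos (be s) - A s * sin (be s))) t 0).
{ intros t Ht.
  assert (Htz : Cmod (RtoC t * z) < 1)
    by (rewrite Cmod_mult, Cmod_R, Rabs_pos_eq by lra; nra).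
  destruct (H _ Htz) as [l [Hg Hf]].
  apply (exp_twist_derive A B al be t (Re (l * f (RtoC t * z) * z)%C)
    (Im (l * f (RtoC t * z) * z)%C) (Re (l * z)%C) (Im (l * z)%C)).
  - apply (quadratic_approx_ray f Re); auto using Re_minus, Rabs_Re_le, Re_scal.
  - apply (quadratic_approx_ray f Im); auto using Im_minus, Rabs_Im_le, Im_scal.
  - apply (quadratic_approx_ray g Re); auto using Re_minus, Rabs_Re_le, Re_scal.
  - apply (quadratic_approx_ray g Im); auto using Im_minus, Rabs_Im_le, Im_scal.
  - unfold A, B. generalize (f (RtoC t * z)%C). intros [x y].
    destruct l as [l1 l2], z as [z1 z2]. unfold Re, Im; simpl. ring.
  - unfold A, B. generalize (f (RtoC t * z)%C). intros [x y].
    destruct l as [l1 l2], z as [z1 z2]. unfold Re, Im; simpl. ring. }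
assert (E1 := eq_is_derive (V := R_NormedModule) _ 0 1 (fun t Ht => proj1 (Hder t Ht)) Rlt_0_1).
assert (E2 := eq_is_derive (V := R_NormedModule) _ 0 1 (fun t Ht => proj2 (Hder t Ht)) Rlt_0_1).
cbv beta in E1, E2. unfold A, B, al, be in E1, E2.
replace (RtoC 0 * z)%C with (RtoC 0) in E1, E2 by cring.
replace (RtoC 1 * z)%C with z in E1, E2 by cring.
rewrite Hf0, Hg0 in E1, E2. unfold Cexp.
destruct (f z) as [x y]. destruct (g z) as [a b]. unfold Re, Im in *; simpl in *.
rewrite Ropp_0, exp_0, cos_0, sin_0 in E1, E2.
assert (He : exp a * exp (- a) = 1) by (rewrite <- exp_plus, Rplus_opp_r; apply exp_0).
assert (Hsc := sin2_cos2 b). unfold Rsqr in Hsc.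
assert (F1 : x * cos b + y * sin b = exp a).
{ replace (x * cos b + y * sin b) with (exp a * (exp (- a) * (x * cos b + y * sin b)))
    by (rewrite <- Rmult_assoc, He; ring). rewrite <- E1. ring. }
assert (F2 : y * cos b - x * sin b = 0).
{ replace (y * cos b - x * sin b) with (exp a * (exp (- a) * (y * cos b - x * sin b)))
    by (rewrite <- Rmult_assoc, He; ring). rewrite <- E2. ring. }
f_equal.
- rewrite <- F1. replace x with (x * (sin b * sin b + cos b * cos b)) at 1 by (rewrite Hsc; ring).
  replace ((x * cos b + y * sin b) * cos b) with
    (x * (sin b * sin b + cos b * cos b) + sin b * (y * cos b - x * sin b)) by ring.
  rewrite F2. ring.
- rewrite <- F1. replace y with (y * (sin b * sin b + cos b * cos b)) at 1 by (rewrite Hsc; ring).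
  replace ((x * cos b + y * sin b) * sin b) with
    (y * (sin b * sin b + cos b * cos b) - cos b * (y * cos b - x * sin b)) by ring.
  rewrite F2. ring.
Qed.

(** The coefficients of the logarithm come from dividing those of [p'] by those of
    [p]; the Cauchy product turns this division into [W' p = p']. *)
Lemma subordinate_Cexp_of_coef (p : C -> C) (a : nat -> C) :
  disk_sum a p -> a 0%nat = RtoC 1 ->
  (forall r N, 0 <= r < 1 -> sum_n (fun n => Cmod (a (S n)) * r ^ S n) N <= 1 / 3) ->
  subordinate p Cexp.
Proof.
intros Hp Ha HS.
destruct (conv_quotient (deriv_coef a) a Ha) as [v Hv].
pose (w := fun n => match n with 0%nat => RtoC 0 | S m => (v m / RtoC (INR (S m)))%C end).
assert (Hwv : forall n, deriv_coef w n = v n).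
{ intros n. unfold deriv_coef, w. field. intros E. apply RtoC_inj in E.
  assert (H := lt_0_INR (S n) ltac:(lia)). lra. }
assert (Hconv : forall n, conv (deriv_coef w) a n = deriv_coef a n).
{ intros n. rewrite <- Hv. apply csum_ext. intros j _. now rewrite Hwv. }
assert (HT : forall r N, 0 <= r < 1 -> sum_n (fun n => Cmod (w (S n)) * r ^ S n) N <= 1 / 2).
{ intros r N Hr. apply log_coef_bound with a; auto; lra. }
assert (Hmaj : forall r, 0 <= r < 1 -> majorized w (1 / 2) r).
{ intros r Hr [|n].
  - simpl. rewrite Cmod_0. lra.
  - eapply Rle_trans; [|apply (HT r n Hr)].
    apply (rsum_term_le (fun n => Cmod (w (S n)) * r ^ S n)); [|lia].
    intros k. apply Rmult_le_pos; [apply Cmod_ge_0|apply pow_le; lra]. }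
assert (Hex : forall z, exists s, Cmod z < 1 -> psum w z s).
{ intros z. destruct (Rlt_le_dec (Cmod z) 1) as [Hz|Hz].
  - assert (Hz0 := Cmod_ge_0 z).
    destruct (psum_ex w _ ((Cmod z + 1) / 2) z (Hmaj ((Cmod z + 1) / 2) ltac:(lra)) ltac:(lra))
      as [s Hs]. now exists s.
  - exists (RtoC 0). lra. }
pose (W := fun z => proj1_sig (constructive_indefinite_description _ (Hex z))).
assert (HW : disk_sum w W) by (intros z; unfold W; apply proj2_sig).
assert (HW0 : W (RtoC 0) = RtoC 0).
{ apply (psum_unique w (RtoC 0)); [apply HW; rewrite Cmod_0; lra|apply (psum_0 w)]. }
assert (HWle : forall z, unit_disk z -> Cmod (W z) <= Cmod z).
{ intros z Hz. apply (schwarz_bound w); auto. }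
assert (Hp0 : p (RtoC 0) = RtoC 1).
{ rewrite <- Ha. apply (psum_unique a (RtoC 0)); [apply Hp; rewrite Cmod_0; lra|apply psum_0]. }
exists W. split; [now apply disk_sum_analytic with w|].
split; [intros z Hz; eapply Rle_lt_trans; [now apply HWle|exact Hz]|].
split; [exact HW0|]. split; [exact HWle|].
intros z Hz. apply Cexp_of_log_derivative; auto.
intros u Hu. assert (Hu0 := Cmod_ge_0 u).
destruct (disk_sum_quadratic w W u HW Hu) as [l [Hl HWq]].
destruct (disk_sum_quadratic a p u Hp Hu) as [l' [Hl' Hpq]].
exists l. split; [exact HWq|].
replace (l * p u)%C with l'; [exact Hpq|].
set (r := (Cmod u + 1) / 2).
destruct (disk_sum_majorized _ _ r (disk_sum_derive w W HW) ltac:(unfold r; lra)) as [M1 [_ HM1]].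
destruct (disk_sum_majorized a p r Hp ltac:(unfold r; lra)) as [M2 [_ HM2]].
apply (psum_unique (deriv_coef a) u); [exact Hl'|].
apply psum_ext with (1 := Hconv).
apply (psum_conv _ _ M1 M2 r); auto. unfold r; lra.
Qed.

(** * The subordination *)

Lemma Cmod_Cexp (z : C) : Cmod (Cexp z) = exp (Re z).
Proof.
replace (Cexp z) with (RtoC (exp (Re z)) * cis (Im z))%C.
- rewrite Cmod_mult, Cmod_cis, Cmod_R, Rabs_pos_eq; [ring|left; apply exp_pos].
- unfold Cexp, cis, Cmult, RtoC; simpl. f_equal; ring.
Qed.

Theorem theorem4p2 (m k : R) (hmk : k >= m) (hm : m >= 2)
    (g1 g2 g3 : R) (hg1 : g1 > 0) (hg2 : g2 > 0) (hg3 : g3 > 0)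
    (hcond :
      g1 - g2 - m ^ 2 * g3 - 3 * m * (k - 1) * g3 - exp 1 * (exp 1 + 1)
        >= exp 1 ^ 2
      \/
      1 - exp 1 - exp 1 * (g1 + g2 + m ^ 2 * g3 + 3 * m * (k - 1) * g3)
        >= exp 1)
    (p : C -> C) (hp : analytic_on_disk p) (hp0 : p (RtoC 0) = RtoC 1)
    (hsub :
      subordinate
        (fun z : C =>
           (p z
            + RtoC g1 * z * C_derive p z
            + RtoC g2 * (z * z) * C_derive (C_derive p) z
            + RtoC g3 * (z * z * z) * C_derive (C_derive (C_derive p)) z)%C)
        (fun z : C => (RtoC 1 + z * Cexp z)%C)) :
  subordinate p Cexp.
Proof.
assert (He : 2 <= exp 1) by (assert (H := exp_ineq1_le 1); lra).
assert (Hmk : 0 <= m ^ 2 * g3 + 3 * m * (k - 1) * g3).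
{ apply Rplus_le_le_0_compat; repeat apply Rmult_le_pos; try lra. }
assert (Hg1 : 5 * exp 1 <= g1).
{ destruct hcond as [H|H]; [nra|].
  assert (0 <= exp 1 * (g1 + g2 + m ^ 2 * g3 + 3 * m * (k - 1) * g3))
    by (apply Rmult_le_pos; lra). lra. }
destruct (analytic_on_disk_psum p hp) as [a Ha].
assert (Ha0 : a 0%nat = RtoC 1).
{ rewrite <- hp0. apply (psum_unique a (RtoC 0)); [apply psum_0|].
  apply Ha. rewrite Cmod_0. lra. }
apply (subordinate_Cexp_of_coef p a Ha Ha0).
intros r N Hr.
(* without its constant term the image of [p] is [om exp om], of modulus at most [e] *)
pose (c := fun n => match n with 0%nat => RtoC 0 | S _ => (RtoC (operator_multiplier g1 g2 g3 n) * a n)%C end).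
assert (Hc : forall z, Cmod z < 1 -> exists s, psum c z s /\ Cmod s <= exp 1).
{ intros z Hz. destruct hsub as [om [_ [Hom1 [_ [_ Hom]]]]].
  assert (Hop := operator_psum g1 g2 g3 p a z Ha Hz).
  cbv beta in Hom. rewrite (Hom z Hz) in Hop.
  exists (om z * Cexp (om z))%C. split.
  - replace (om z * Cexp (om z))%C
      with (RtoC 1 + om z * Cexp (om z) - RtoC (operator_multiplier g1 g2 g3 0) * a 0%nat)%C.
    + exact (psum_without_constant _ _ _ Hop).
    + rewrite Ha0. unfold operator_multiplier. simpl INR.
      replace (1 + g1 * 0 + g2 * (0 * (0 - 1)) + g3 * (0 * (0 - 1) * (0 - 2))) with 1 by ring.
      cring.
  - rewrite Cmod_mult, Cmod_Cexp.
    assert (H1 := Hom1 z Hz). unfold unit_disk in H1.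
    assert (H2 := Rabs_Re_le (om z)). assert (H3 := Cmod_ge_0 (om z)).
    assert (H4 : exp (Re (om z)) <= exp 1).
    { left. apply exp_increasing. apply Rabs_le_between in H2. lra. }
    assert (H5 := exp_pos (Re (om z))). nra. }
set (rho := (r + 1) / 2).
assert (Erho : Cmod (RtoC rho) = rho) by (rewrite Cmod_R; apply Rabs_pos_eq; unfold rho; lra).
destruct (Hc (RtoC rho)) as [s [Hs _]]; [rewrite Erho; unfold rho; lra|].
destruct (psum_majorized _ _ _ Hs) as [M [_ HM]]. rewrite Erho in HM.
apply (l1_bound_of_multiplier a c (exp 1) r N); [lra|lra| |].
- intros n. unfold c. rewrite Cmod_mult, Cmod_R.
  assert (Hn := lt_0_INR (S n) ltac:(lia)).
  assert (Hsym := operator_multiplier_ge g1 g2 g3 (S n) ltac:(lra) ltac:(lra)).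
  apply Rmult_le_compat_r; [apply Cmod_ge_0|].
  eapply Rle_trans; [|apply Rle_abs]. nra.
- assert (HP := psum_parseval c M rho r (exp 1) HM ltac:(unfold rho; lra)).
  assert (HPS : sum_n (fun k0 => (Cmod (c k0) * r ^ k0) ^ 2) (S N) <= exp 1 ^ 2).
  { apply HP. intros z Hz. apply Hc. lra. }
  assert (E : forall n, sum_n (fun k0 => (Cmod (c k0) * r ^ k0) ^ 2) (S n) =
    sum_n (fun n => (Cmod (c (S n)) * r ^ S n) ^ 2) n).
  { induction n as [|n IH].
    - rewrite rsum_S, !rsum_0. unfold c at 1. rewrite Cmod_0. lra.
    - rewrite rsum_S, IH, (rsum_S (fun n => (Cmod (c (S n)) * r ^ S n) ^ 2)). reflexivity. }
  rewrite <- E. exact HPS.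
Qed.
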